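(* Let $H_\omega=-\Delta+V_\omega$ be the Anderson model on the Sierpinski lattice $\mathbb{G}$. Then almost surely $$\sigma(-\Delta)+\operatorname{supp}P_0\;\subseteq\;\sigma(H_\omega)\;\subseteq\;\sigma(-\Delta)+\Big[\inf_{x\in\mathbb{G}}V_\omega(x),\ \sup_{x\in\mathbb{G}}V_\omega(x)\Big],$$ and $$\sigma(H_\omega)\subseteq[0,6]+\operatorname{supp}P_0 .$$ In particular, if $\operatorname{supp}P_0=[a,b]$ for some $-\infty\le a<b\le\infty$ (interpreted as the corresponding closed, possibly unbounded, interval), then almost surely $\sigma(H_\omega)=\sigma(-\Delta)+\operatorname{supp}P_0$.
   Context: Let $a_1=(0,0)$, $a_2=(1,0)$, $a_3=(1/2,\sqrt3/2)$, let $T_0\subset\mathbb{R}^2$ be the unit equilateral triangle with vertices $a_1,a_2,a_3$, and recursively $T_{n+1}=T_n\cup(T_n+2^na_2)\cup(T_n+2^na_3)$, so $T_n$ is a union of $3^n$ translates of $T_0$ (''unit triangles''). Let $\mathbb{G}_n$ be the set of all vertices of unit triangles in $T_n$; two points $x\ne y$ are adjacent ($x\sim y$) iff they are vertices of a common unit triangle. Let $\mathbb{G}_n'$ (and its edges) be the mirror image of $\mathbb{G}_n$ with respect to the $y$-axis. The (full) Sierpinski lattice is the infinite graph with vertex set $\mathbb{G}=\bigcup_{n\ge0}(\mathbb{G}_n\cup\mathbb{G}_n')$ and the union of these edges; every vertex has degree $4$. The graph Laplacian on $\ell^2(\mathbb{G})$ (usual unweighted inner product) is $\Delta f(x)=\sum_{y\sim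 x}(f(y)-f(x))$. The Anderson model is $H_\omega=-\Delta+V_\omega$ where $V_\omega$ acts by multiplication and $\{V_\omega(x)\}_{x\in\mathbb{G}}$ are i.i.d. real random variables with common distribution $P_0$; $\operatorname{supp}P_0=\{x\in\mathbb{R}: P_0((x-\varepsilon,x+\varepsilon))>0 \text{ for all }\varepsilon>0\}$. $\sigma(\cdot)$ denotes spectrum and $A+B=\{a+b:a\in A,b\in B\}$. *)

(* Defs.v *)
From HB Require Import structures.
From mathcomp Require Import all_boot all_order all_algebra.
From mathcomp Require Import all_classical all_reals all_analysis.
Set Implicit Arguments. Unset Strict Implicit. Unset Printing Implicit Defensive.
Import Order.TTheory GRing.Theory Num.Theory.
Import numFieldNormedType.Exports.
Local Open Scope classical_set_scope.
Local Open Scope ring_scope.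

(* ---------- The Sierpinski lattice ---------------------------------------
   A point i*a2 + j*a3 of the plane (a2 = (1,0), a3 = (1/2, sqrt3/2)) is
   encoded by its integer coordinates (i, j).  Every vertex of every unit
   triangle of T_n (and of its mirror image) is of this form.            *)
Definition pt := (int * int)%type.

Definition padd (p q : pt) : pt := (p.1 + q.1, p.2 + q.2).

(* reflection in the y-axis: (i + j/2, j sqrt3/2) |-> (-i - j/2, j sqrt3/2),
   i.e. (i, j) |-> (-i-j, j) in lattice coordinates *)
Definition mirror (p : pt) : pt := (- p.1 - p.2, p.2).

(* S n = translation vectors of the 3^n unit triangles of T_n:
   T_0 = T0 + (0,0),  T_{n+1} = T_n u (T_n + 2^n a2) u (T_n + 2^n a3) *)
Fixpoint S (n : nat) : set pt :=
  match n with
  | 0%N => [set ((0:int), (0:int))]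
  | n'.+1 => S n' `|` [set padd t ((2 ^ n')%N%:Z, 0) | t in S n']
                  `|` [set padd t (0, (2 ^ n')%N%:Z) | t in S n']
  end.

Definition tri (t : pt) : set pt :=
  [set t; padd t (1, 0); padd t (0, 1)].

Definition Gn (n : nat) : set pt := \bigcup_(t in S n) tri t.
Definition Gn' (n : nat) : set pt := mirror @` Gn n.

Definition G : set pt := \bigcup_(n in setT) (Gn n `|` Gn' n).

Definition adj (x y : pt) : Prop :=
  x <> y /\ exists n t, S n t /\
    ((tri t x /\ tri t y) \/ (tri t (mirror x) /\ tri t (mirror y))).

Section Operators.
Variable R : realType.

Definition lap (f : pt -> R) (x : pt) : R :=
  \sum_(y \in [set y | adj x y]) (f y - f x).

Definition nsq (f : pt -> R) : \bar R := \esum_(x in G) ((f x) ^+ 2)%:E.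

Definition l2 (f : pt -> R) : Prop :=
  (forall x, ~ G x -> f x = 0) /\ (nsq f < +oo)%E.

Definition Hop (V : pt -> R) (f : pt -> R) (x : pt) : R :=
  if `[< G x >] then - lap f x + V x * f x else 0.

(* lambda is in the resolvent set of H (with its natural, maximal domain
   D(H) = {f in l^2(G) | Hf in l^2(G)}): H - lambda : D(H) -> l^2(G) has a
   bounded two-sided inverse. *)
Definition resolvent (V : pt -> R) (lam : R) : Prop :=
  exists (Rs : (pt -> R) -> (pt -> R)) (C : R),
    (forall f, l2 f ->
        [/\ l2 (Rs f), l2 (Hop V (Rs f)),
            (forall x, Hop V (Rs f) x - lam * Rs f x = f x) &
            (nsq (Rs f) <= C%:E * nsq f)%E]) /\
    (forall f, l2 f -> l2 (Hop V f) ->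
        Rs (fun x => Hop V f x - lam * f x) = f).

(* spectrum sigma(H) (a subset of R, H being self-adjoint) *)
Definition spectrum (V : pt -> R) : set R := ~` resolvent V.

Definition minksum (A B : set R) : set R := [set a + b | a in A & b in B].

Definition ball_itv (x e : R) : set R := `]x - e, x + e[.

Definition supp (P0 : set R -> \bar R) : set R :=
  [set x | forall e : R, 0 < e -> (0 < P0 (ball_itv x e))%E].

Definition eitv (a b : \bar R) : set R := [set t | (a <= t%:E <= b)%E].

End Operators.

Definition iid_family {R : realType} {d : measure_display}
    {Omega : measurableType d} (P : probability Omega R)
    (V : pt -> Omega -> R) (P0 : probability R R) : Prop :=
  (forall x, G x -> measurable_fun setT (V x)) /\
  (forall x, G x -> forall B : set R, measurable B ->
      P (V x @^-1` B) = P0 B) /\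
  (forall (s : seq pt) (B : pt -> set R), uniq s ->
      (forall x, x \in s -> G x) -> (forall x, measurable (B x)) ->
      P (\bigcap_(x in [set` s]) (V x @^-1` B x)) =
      (\prod_(x <- s) P (V x @^-1` B x))%E).

(* Main.v *)
(** -Delta is a sum over triangles of 3 times the projection orthogonal to the
    constants, and every vertex lies in at most two triangles; hence
    0 <= -Delta <= 6.  A real number lies in the spectrum of a bounded finite-range
    symmetric operator iff it has finitely supported Weyl sequences.

    Lower inclusion: every finite piece of the lattice has infinitely many disjoint
    translated copies, so by independence almost surely on one of them the
    potential is uniformly close to a prescribed point E of the support.
    Translating a Weyl sequence for lam to such copies yields one for lam + E.

    Upper inclusions: H - z is inverted by a contraction argument, around the
    resolvent of -Delta when V is bounded, and around the diagonal operator
    V + c - z when -Delta - c is smaller than that diagonal.  The latter covers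
    potentials that are unbounded on one side. *)

Require Import Defs.
From HB Require Import structures.
From mathcomp Require Import all_boot all_order all_algebra.
From mathcomp Require Import all_classical all_reals all_analysis.
From mathcomp Require Import zify ring lra.
Import Order.TTheory GRing.Theory Num.Theory.
Local Open Scope classical_set_scope.
Local Open Scope ring_scope.
Set Implicit Arguments.
Unset Strict Implicit.
Unset Printing Implicit Defensive.

(** * Triangles of the lattice *)

(** No spectral theorem or functional calculus is used. All operator inequalities are statements
    about quadratic forms on finitely supported functions, and finite range carries them over to
    l^2. Norms occur only as upper bounds, and every inverse is the fixed point of a contraction.

    The lattice has a seam at the origin, where two mirror-image halves are glued, so a finite piece
    around the origin has no evident copy inside one half. But T_n is symmetric under reflection in
    its own vertical axis. Hence the corner shared by the two bottom copies of T_n in any copy of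
    T_{n+1} looks, up to scale [2 ^ n], exactly like the origin.

    For a bounded potential with values in [a, b], centre c and half-length r, the condition that z
    is outside the spectrum of -Delta plus [a, b] says that z - c is farther than r from the free
    spectrum. This is just what makes the perturbation V - c a contraction, provided that the
    inverse is bounded by the reciprocal of that distance and not by some cruder constant. *)

Definition flip (t : pt) : pt := (- t.1 - t.2 - 1, t.2).

(* [t] is the lower left corner of a unit triangle of the lattice; the mirror
   image of the triangle at [t'] is the upright triangle at [flip t']. *)
Definition base (t : pt) : Prop := exists n, S n t \/ S n (flip t).

Lemma S_recE n (i j : int) : S n.+1 (i, j) <->
  [\/ S n (i, j), S n (i - (2 ^ n)%N%:Z, j) | S n (i, j - (2 ^ n)%N%:Z)].
Proof.
have e1 (a b c d : int) : padd (a, b) (c, d) = (a + c, b + d) by [].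
split=> [[[H|[[a b] H]]|[[a b] H]]|[H|H|H]] /=.
- by apply: Or31.
- by rewrite e1 => -[<- <-]; apply: Or32; rewrite addr0 addrK.
- by rewrite e1 => -[<- <-]; apply: Or33; rewrite addr0 addrK.
- by left; left.
- by left; right; exists (i - (2 ^ n)%N%:Z, j) => //; rewrite e1 addr0 subrK.
- by right; exists (i, j - (2 ^ n)%N%:Z) => //; rewrite e1 addr0 subrK.
Qed.

Lemma S_bound n (i j : int) : S n (i, j) ->
  [/\ 0 <= i, 0 <= j & i + j < (2 ^ n)%N%:Z].
Proof.
elim: n i j => [|n IH] i j; first by case=> -> ->.
have e2 := expnS 2 n.
by case/S_recE => /IH [] *; split; lia.
Qed.

Lemma S_mono n m t : (n <= m)%N -> S n t -> S m t.
Proof.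
move=> /subnK <-; elim: (m - n)%N => [//|k IH] /IH H.
by rewrite addSn; left; left.
Qed.

(** Each later stage only adds translates beyond the line [i + j = 2 ^ n], so membership below that
    line is already decided at stage [n]. *)
Lemma S_stable n m (i j : int) : i + j < (2 ^ n)%N%:Z -> S m (i, j) -> S n (i, j).
Proof.
move=> ij; elim: m => [|m IH]; first exact: S_mono.
have [mn|nm] := leqP m.+1 n; first exact: S_mono.
have le2 : (2 ^ n <= 2 ^ m)%N by rewrite leq_exp2l.
by case/S_recE => [/IH //|/S_bound[]|/S_bound[]]; lia.
Qed.

(** Reflection of T_n in its own vertical axis: it swaps the two bottom copies and preserves the top
    one. *)
Lemma S_flip n (i j : int) : S n (i, j) -> S n ((2 ^ n)%N%:Z - 1 - i - j, j).
Proof.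
elim: n i j => [|n IH] i j; first by case=> -> ->.
have e2 := expnS 2 n.
case/S_recE => /IH H; apply/S_recE; [apply: Or32|apply: Or31|apply: Or33];
 move: H; congr (S n (_, _)); lia.
Qed.

(** These are the three upright triangles around the vertex [(i, j)]. Different copies inside
    T_{n+1} meet only in a corner, and there the third triangle would stick out of T_{n+1}. *)
Lemma S_at_most_two n (i j : int) : S n (i, j) -> S n (i - 1, j) -> S n (i, j - 1) -> False.
Proof.
elim: n i j => [|n IH] i j; first by case=> -> -> [].
have e1 : i - 1 - (2 ^ n)%N%:Z = i - (2 ^ n)%N%:Z - 1 by lia.
have e2 : j - 1 - (2 ^ n)%N%:Z = j - (2 ^ n)%N%:Z - 1 by lia.
case/S_recE => H /S_recE H1 /S_recE H2; case: H1 => H1; case: H2 => H2;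
  rewrite ?e1 ?e2 in H1 H2; try (exact: IH H H1 H2);
  have [? ? ?] := S_bound H; have [? ? ?] := S_bound H1;
  have [? ? ?] := S_bound H2; lia.
Qed.

(** Within one half this is [S_at_most_two]; the mirror exchanges the first two triangles. The
    halves share only the origin, where the third triangle would lie below the x-axis. *)
Lemma base_at_most_two (x : pt) :
  base x -> base (x.1 - 1, x.2) -> base (x.1, x.2 - 1) -> False.
Proof.
case: x => i j [n H] [m H1] [k H2]; rewrite /flip /= in H H1 H2.
pose N := maxn n (maxn m k).
have {}H : S N (i, j) \/ S N (- i - j - 1, j).
  by case: H => H; [left|right]; apply: S_mono H; rewrite leq_maxl.
have {}H1 : S N (i - 1, j) \/ S N (- i - j, j).
  case: H1 => H1; [left|right]; (apply: (@S_mono m); first lia) => //.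
  by move: H1; congr (S m (_, _)); lia.
have {}H2 : S N (i, j - 1) \/ S N (- i - j, j - 1).
  case: H2 => H2; [left|right]; (apply: (@S_mono k); first lia) => //.
  by move: H2; congr (S k (_, _)); lia.
case: H => H; case: H1 => H1; case: H2 => H2;
  have [? ? ?] := S_bound H; have [? ? ?] := S_bound H1;
  have [? ? ?] := S_bound H2; try lia.
- exact: S_at_most_two H H1 H2.
- exact: S_at_most_two H1 H H2.
Qed.

Lemma S_shift n (i j : int) : 0 <= i -> 0 <= j -> i + j < (2 ^ n)%N%:Z ->
  (exists m, S m (i + (2 ^ n)%N%:Z, j)) <-> (exists m, S m (i, j)).
Proof.
move=> i0 j0 ij; have e2 := expnS 2 n; split=> -[m].
- move/(@S_stable n.+1 m) => H; have /S_recE[] := H ltac:(lia).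
  + by case/S_bound; lia.
  + by rewrite addrK; exists n.
  + by case/S_bound; lia.
- move/(@S_stable n m) => H; exists n.+1; apply/S_recE; apply: Or32.
  by rewrite addrK; apply: H.
Qed.

(** The origin is moved to the midpoint of the bottom side of the copy of T_{n+1} that starts at
    [2 ^ (n.+1 + k)]. To the right of that midpoint there is a translate of T_n; to the left there
    is another one, which [S_flip] identifies with the mirror half. *)
Lemma base_shift (n k : nat) (i j : int) : `|i| + `|j| < (2 ^ n)%N%:Z ->
  base (i + ((2 ^ n)%N%:Z + (2 ^ (n.+1 + k))%N%:Z), j) <-> base (i, j).
Proof.
move=> ij; have e2 := expnS 2 n.
have le2 : (2 ^ n.+1 <= 2 ^ (n.+1 + k))%N by rewrite leq_exp2l // leq_addr.
have baseE (a b : int) : base (a, b) <->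
    (exists m, S m (a, b)) \/ (exists m, S m (- a - b - 1, b)).
  split=> [[m [H|H]]|[[m H]|[m H]]]; [left|right|exists m|exists m];
  by [exists m|exists m|left|right].
have [j0|j0] := ltP j 0.
  by split=> /baseE [] [m /S_bound[]]; lia.
rewrite !baseE.
have noL : ~ (exists m, S m (- (i + ((2 ^ n)%N%:Z + (2 ^ (n.+1 + k))%N%:Z)) - j - 1, j)).
  by case=> m /S_bound[]; lia.
(* The large power only selects the right-hand copy inside T_{n+2+k}; what remains takes place in
   T_{n+1}. *)
have sh : (exists m, S m (i + ((2 ^ n)%N%:Z + (2 ^ (n.+1 + k))%N%:Z), j)) <->
          (exists m, S m (i + (2 ^ n)%N%:Z, j)).
  by rewrite addrA; apply: S_shift; lia.
rewrite sh; have [i0|i0] := leP 0 i.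
  rewrite S_shift //; last lia.
  have : ~ (exists m, S m (- i - j - 1, j)) by case=> m /S_bound[]; lia.
  tauto.
have noR : ~ (exists m, S m (i, j)) by case=> m /S_bound[]; lia.
(* Left of the seam: T_n shifted by [- 2 ^ n] coincides with the mirror image of T_n. *)
suff : (exists m, S m (i + (2 ^ n)%N%:Z, j)) <-> (exists m, S m (- i - j - 1, j)).
  tauto.
split=> -[m].
- move/(@S_stable n.+1 m) => H; have /S_recE[{}H|/S_bound[]|/S_bound[]] := H ltac:(lia); try lia.
  by exists n; have := S_flip H; congr (S n (_, _)); lia.
- move=> H; exists n; have [? ? ?] := S_bound H.
  have := S_flip (@S_stable n m _ _ _ H) => /(_ ltac:(lia)).
  by congr (S n (_, _)); lia.
Qed.

Lemma tri_mirror (t x : pt) : tri t (mirror x) <-> tri (flip t) x.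
Proof.
case: t x => [a b] [i j]; rewrite /tri /mirror /flip /padd /=.
split=> [[[[e1 e2]|[e1 e2]]|[e1 e2]]|[[[e1 e2]|[e1 e2]]|[e1 e2]]].
- by left; right; congr (_, _); lia.
- by left; left; congr (_, _); lia.
- by right; congr (_, _); lia.
- by left; right; congr (_, _); lia.
- by left; left; congr (_, _); lia.
- by right; congr (_, _); lia.
Qed.

Lemma flipK (t : pt) : flip (flip t) = t.
Proof. by case: t => i j; rewrite /flip /=; congr (_, _); lia. Qed.

Lemma mirrorK (x : pt) : mirror (mirror x) = x.
Proof. by case: x => i j; rewrite /mirror /=; congr (_, _); lia. Qed.

Lemma adjE (x y : pt) : adj x y <->
  x <> y /\ exists t, [/\ base t, tri t x & tri t y].
Proof.
split=> -[xy H]; split=> //.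
- case: H => n [t [Sn [[tx ty]|[/tri_mirror tx /tri_mirror ty]]]].
    by exists t; split=> //; exists n; left.
  by exists (flip t); split=> //; exists n; right; rewrite flipK.
- case: H => t [[n [H|H]] tx ty]; first by exists n, t; split=> //; left.
  exists n, (flip t); split=> //; right.
  by rewrite !tri_mirror flipK.
Qed.

Lemma GE (x : pt) : G x <-> exists t, base t /\ tri t x.
Proof.
split.
- case=> n _ [[t St tx]|[y [t St ty] <-]]; first by exists t; split=> //; exists n; left.
  exists (flip t); split; first by exists n; right; rewrite flipK.
  by apply/(tri_mirror t); rewrite mirrorK.
- case=> t [[n [H|H]] tx]; exists n => //; first by left; exists t.
  right; exists (mirror x); last exact: mirrorK.
  by exists (flip t) => //; apply/(tri_mirror (flip t)); rewrite flipK.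
Qed.

Lemma triE (t x : pt) : tri t x <->
  [\/ t = x, t = (x.1 - 1, x.2) | t = (x.1, x.2 - 1)].
Proof.
case: t x => [a b] [i j]; rewrite /tri /padd /=.
split=> [[[[-> ->]|[-> ->]]|[-> ->]]|[[-> ->]|[-> ->]|[-> ->]]].
- exact: Or31.
- by apply: Or32; congr (_, _); lia.
- by apply: Or33; congr (_, _); lia.
- by left; left.
- by left; right; congr (_, _); lia.
- by right; congr (_, _); lia.
Qed.

Lemma G0 : G (0, 0).
Proof. by apply/GE; exists (0, 0); split; [exists 0%N; left|left; left]. Qed.

(** * Square-summable functions and contractions *)

Section SquareSummable.
Variables (R : realType) (I : choiceType) (D : set I).
Implicit Types (f g u : I -> R) (s : seq I) (a b c e q : R).

Definition sumsq f s : R := \sum_(x <- s) f x ^+ 2.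

Definition onD f := forall x, ~ D x -> f x = 0.

(* [bnd f c]: the norm of [f] in l^2(D) is at most [c]. *)
Definition bnd f c :=
  [/\ onD f, 0 <= c & forall s, uniq s -> sumsq f s <= c ^+ 2].

Definition isl2 f := exists c, bnd f c.

Lemma sumsq_ge0 f s : 0 <= sumsq f s.
Proof. by apply: sumr_ge0 => x _; exact: sqr_ge0. Qed.

Lemma sumsq_eq0 f s x : sumsq f s = 0 -> x \in s -> f x = 0.
Proof.
move=> /eqP; rewrite /sumsq psumr_eq0; last by move=> ? _; exact: sqr_ge0.
by move=> /allP H /H /=; rewrite sqrf_eq0 => /eqP.
Qed.

Lemma eq_sumsq f g s : {in s, f =1 g} -> sumsq f s = sumsq g s.
Proof. by move=> fg; apply: eq_big_seq => x xs; rewrite fg. Qed.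

(** Minkowski's inequality without square roots: pointwise, [(a + b) * (b * f^2 + a * g^2) - a * b *
    (f + g)^2] is the square of [b * f - a * g]. The cases [a = 0] and [b = 0] are separate because
    the weight [a * b] is cancelled. *)
Lemma sumsqD f g s a b : 0 <= a -> 0 <= b ->
  sumsq f s <= a ^+ 2 -> sumsq g s <= b ^+ 2 -> sumsq (f + g) s <= (a + b) ^+ 2.
Proof.
move=> a0 b0 fa gb.
have [a_eq|a_neq] := eqVneq a 0.
  have f0 : sumsq f s = 0.
    by apply/eqP; rewrite eq_le sumsq_ge0 andbT (le_trans fa)// a_eq expr0n.
  rewrite a_eq add0r (@eq_sumsq _ g)// => x xs.
  by rewrite !fctE (sumsq_eq0 f0 xs) add0r.
have [b_eq|b_neq] := eqVneq b 0.
  have g0 : sumsq g s = 0.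
    by apply/eqP; rewrite eq_le sumsq_ge0 andbT (le_trans gb)// b_eq expr0n.
  rewrite b_eq addr0 (@eq_sumsq _ f)// => x xs.
  by rewrite !fctE (sumsq_eq0 g0 xs) addr0.
have {}a0 : 0 < a by rewrite lt_neqAle eq_sym a_neq.
have {}b0 : 0 < b by rewrite lt_neqAle eq_sym b_neq.
have ab : 0 < a * b by rewrite mulr_gt0.
rewrite -(ler_pM2l ab).
have : a * b * sumsq (f + g) s <= (a + b) * (b * sumsq f s + a * sumsq g s).
  rewrite /sumsq !mulr_sumr -big_split/= mulr_sumr; apply: ler_sum => x _.
  rewrite !fctE -subr_ge0.
  have -> : (a + b) * (b * f x ^+ 2 + a * g x ^+ 2) - a * b * (f x + g x) ^+ 2
    = (b * f x - a * g x) ^+ 2 by ring.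
  exact: sqr_ge0.
move/le_trans; apply.
have -> : a * b * (a + b) ^+ 2 = (a + b) * (b * a ^+ 2 + a * b ^+ 2) by ring.
by rewrite ler_pM2l ?addr_gt0// lerD// ler_pM2l.
Qed.

Lemma bnd_ge0 f c : bnd f c -> 0 <= c. Proof. by case. Qed.

Lemma bnd_onD f c : bnd f c -> onD f. Proof. by case. Qed.

Lemma bnd_at f c x : bnd f c -> `|f x| <= c.
Proof.
move=> [_ c0 /(_ [:: x] isT)]; rewrite /sumsq big_seq1 -real_normK ?num_real//.
by rewrite ler_sqr ?nnegrE.
Qed.

Lemma bndW f a b : a <= b -> bnd f a -> bnd f b.
Proof.
move=> ab [f0 a0 fa]; split=> //; first exact: le_trans ab.
by move=> s /fa /le_trans; apply; rewrite ler_sqr ?nnegrE// (le_trans a0).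
Qed.

Lemma bnd0 : bnd 0 0.
Proof. by split=> // s _; rewrite /sumsq big1 ?expr0n// => ? _; rewrite expr0n. Qed.

Lemma bndD f g a b : bnd f a -> bnd g b -> bnd (f + g) (a + b).
Proof.
move=> [f0 a0 fa] [g0 b0 gb]; split; last by move=> s us; apply: sumsqD; auto.
- by move=> x Dx; rewrite !fctE f0// g0// addr0.
- exact: addr_ge0.
Qed.

Lemma bndM f a w c : 0 <= c -> (forall x, D x -> `|w x| <= c) ->
  bnd f a -> bnd (fun x => w x * f x) (c * a).
Proof.
move=> c0 wc [f0 a0 fa]; split.
- by move=> x Dx; rewrite f0// mulr0.
- exact: mulr_ge0.
- move=> s /fa H; rewrite exprMn.
  apply: (@le_trans _ _ (c ^+ 2 * sumsq f s)); last by rewrite ler_wpM2l ?sqr_ge0.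
  rewrite /sumsq mulr_sumr; apply: ler_sum => x _; rewrite exprMn.
  have [Dx|Dx] := pselect (D x); last by rewrite f0// expr0n !mulr0.
  by rewrite ler_wpM2r ?sqr_ge0// -[leLHS]real_normK ?num_real// ler_sqr ?nnegrE// wc.
Qed.

Lemma bndZ f a k : bnd f a -> bnd (k *: f) (`|k| * a).
Proof. by move=> fa; apply: (@bndM f a (cst k)) fa. Qed.

Lemma bndB f g a b : bnd f a -> bnd g b -> bnd (f - g) (a + b).
Proof.
move=> fa /(bndZ (- 1)); rewrite normrN normr1 mul1r scaleN1r => gb.
exact: bndD.
Qed.

Lemma bnd_le f c : (forall e, 0 < e -> bnd f (c + e)) -> bnd f c.
Proof.
move=> H; have c0 : 0 <= c.
  by apply/ler_addgt0Pr => e e0; case: (H _ e0).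
split=> //; first by case: (H 1 ltr01).
move=> s us; rewrite -(sqr_sqrtr (sumsq_ge0 f s)) ler_sqr ?nnegrE ?sqrtr_ge0//.
apply/ler_addgt0Pr => e e0; have [_ ce fe] := H _ e0.
by rewrite -[leRHS](ger0_norm ce) -sqrtr_sqr ler_wsqrtr// fe.
Qed.

(** Lower semicontinuity of the norm under pointwise approximation. On a list of [N] points an error
    of [e / (N + 1)] at each point costs at most [e] in norm. *)
Lemma bnd_approx f c : onD f -> 0 <= c ->
  (forall s e, 0 < e -> exists2 g, bnd g c & {in s, forall x, `|f x - g x| <= e}) ->
  bnd f c.
Proof.
move=> f0 c0 H; apply: bnd_le => e e0; split=> //; first by rewrite addr_ge0// ltW.
move=> s us; pose N : R := (size s)%:R.
have N0 : 0 <= N by rewrite ler0n.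
have d0 : 0 < e / (N + 1) by rewrite divr_gt0// ltr_wpDl.
have [g [_ _ gc] fg] := H s _ d0.
have -> : f = g + (f - g) by rewrite addrC subrK.
apply: sumsqD; rewrite ?(ltW e0) ?gc//.
apply: (@le_trans _ _ (\sum_(x <- s) (e / (N + 1)) ^+ 2)).
  rewrite /sumsq big_seq [leRHS]big_seq; apply: ler_sum => x xs.
  rewrite !fctE -real_normK ?num_real// ler_sqr ?nnegrE ?(ltW d0)//; exact: fg.
rewrite big_const_seq count_predT iter_addr_0 -mulr_natl -/N.
have -> : N * (e / (N + 1)) ^+ 2 = e ^+ 2 * (N / (N + 1) ^+ 2).
  by field; rewrite gt_eqF// ltr_wpDl.
rewrite ler_piMr ?sqr_ge0// ler_pdivrMr ?mul1r ?exprn_gt0 ?ltr_wpDl//; nra.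
Qed.

Lemma bnd_eq0 f : (forall e, 0 < e -> bnd f e) -> f = 0.
Proof.
move=> H; apply/funext => x; apply/eqP; rewrite -normr_le0.
apply/ler_addgt0Pr => e e0; rewrite add0r; exact: bnd_at (H _ e0).
Qed.

Lemma isl2D f g : isl2 f -> isl2 g -> isl2 (f + g).
Proof. by move=> [a fa] [b gb]; exists (a + b); apply: bndD. Qed.

Lemma isl2B f g : isl2 f -> isl2 g -> isl2 (f - g).
Proof. by move=> [a fa] [b gb]; exists (a + b); apply: bndB. Qed.

Lemma isl2Z f k : isl2 f -> isl2 (k *: f).
Proof. by move=> [a fa]; exists (`|k| * a); apply: bndZ. Qed.

Lemma geometric_small q c e : 0 <= q < 1 -> 0 < e -> exists n, c * q ^+ n < e.
Proof.
move=> /andP[q0 q1] e0.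
have : (geometric c q @ \oo --> 0)%classic.
  by apply: cvg_geometric; rewrite ger0_norm.
move=> /cvgrPdist_lt /(_ _ e0) [n _ /(_ n (leqnn n))] /=.
rewrite sub0r normrN => H; exists n; exact: le_lt_trans (ler_norm _) H.
Qed.

Section Contraction.
Variables (Phi : (I -> R) -> I -> R) (q : R).
Hypothesis q01 : 0 <= q < 1.
Hypothesis PhiB : forall f g, isl2 f -> isl2 g -> Phi (f - g) = Phi f - Phi g.
Hypothesis Phi_bnd : forall f c, bnd f c -> bnd (Phi f) (q * c).

Lemma contraction_fix0 u : isl2 u -> u = Phi u -> u = 0.
Proof.
move=> [c uc] uE; apply: bnd_eq0 => e e0.
have [n ne] := geometric_small c q01 e0; apply: bndW (ltW ne) _.
elim: n {ne} => [|n IH]; first by rewrite mulr1.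
by rewrite uE exprS mulrCA; apply: Phi_bnd.
Qed.

(** Picard iteration from 0. Additivity of [Phi] is assumed only on l^2, since one application takes
    [Phi] from an inverse that is merely chosen there; hence every iterate carries its bound. *)
Lemma contraction_solve g c : bnd g c ->
  exists2 u, bnd u (c / (1 - q)) & u = g + Phi u.
Proof.
move=> gc; have /andP[q0 q1] := q01; have q1' : 0 < 1 - q by rewrite subr_gt0.
have c0 := bnd_ge0 gc.
have [C CD] : exists C, C = c / (1 - q) by exists (c / (1 - q)).
rewrite -CD; have C0 : 0 <= C by rewrite CD divr_ge0// ltW.
(* The ball of radius [C] is mapped into itself by the iteration. *)
have CE : C = c + q * C by rewrite CD; field; rewrite gt_eqF.
pose S_ n := iter n (fun u => g + Phi u) 0.
have SC n : bnd (S_ n) C.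
  elim: n => [|n IH]; first exact: (bndW C0 bnd0).
  by rewrite [S_ n.+1]/= -/(S_ n) CE; apply: bndD => //; apply: Phi_bnd.
have S_l2 n : isl2 (S_ n) by exists C.
have SB n m : bnd (S_ (n + m)%N - S_ n) (C * q ^+ n).
  elim: n => [|n IH]; first by rewrite add0n subr0 mulr1.
  have -> : S_ (n.+1 + m)%N - S_ n.+1 = Phi (S_ (n + m)%N - S_ n).
    by rewrite PhiB// addSn [S_ _.+1]/= [S_ n.+1]/= opprD addrACA subrr add0r.
  by rewrite exprS mulrCA; apply: Phi_bnd.
have Spt n m x : (n <= m)%N -> `|S_ m x - S_ n x| <= C * q ^+ n.
  by move=> nm; have := bnd_at x (SB n (m - n)%N); rewrite subnKC.
have q_anti n m : (n <= m)%N -> q ^+ m <= q ^+ n.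
  by move=> nm; rewrite ler_wiXn2l// ltW.
(* The intervals of radius [C q^n] around [S_ n x] pairwise intersect; taking
   the supremum of their left endpoints as limit avoids Cauchy sequences. *)
pose L x := [set S_ n x - C * q ^+ n | n in [set: nat]].
pose u x := sup (L x).
have LU x n m : S_ n x - C * q ^+ n <= S_ m x + C * q ^+ m.
  have [nm|/ltnW mn] := leqP n m.
    have := Spt _ _ x nm; rewrite ler_norml => /andP[h _].
    have := mulr_ge0 C0 (exprn_ge0 m q0); lra.
  have := Spt _ _ x mn; rewrite ler_norml => /andP[_ h].
  have := mulr_ge0 C0 (exprn_ge0 n q0); lra.
have uS x n : `|u x - S_ n x| <= C * q ^+ n.
  rewrite ler_distl; apply/andP; split.
    apply: ub_le_sup; last by exists n.
    by exists (S_ 0%N x + C * q ^+ 0) => _ [m _ <-]; exact: LU.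
  apply: ge_sup; first by exists (S_ 0%N x - C * q ^+ 0), 0%N.
  by move=> _ [m _ <-]; exact: LU.
have u0 : onD u.
  move=> x Dx; apply/eqP; rewrite -normr_le0; apply/ler_addgt0Pr => e e0.
  have [n /ltW ne] := geometric_small C q01 e0; rewrite add0r; apply: le_trans ne.
  by have := uS x n; rewrite (bnd_onD (SC n) Dx) subr0.
have uSb n : bnd (u - S_ n) (C * q ^+ n).
  apply: bnd_approx; rewrite ?mulr_ge0 ?exprn_ge0//.
    by move=> x Dx; rewrite !fctE u0// (bnd_onD (SC n) Dx) subr0.
  move=> s e e0; have [m /ltW me] := geometric_small C q01 e0.
  exists (S_ (n + m)%N - S_ n) => // x _.
  rewrite !fctE; have -> : u x - S_ n x - (S_ (n + m)%N x - S_ n x) =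
    u x - S_ (n + m)%N x by lra.
  apply: le_trans me; apply: le_trans (uS _ _) _.
  by rewrite ler_wpM2l// q_anti// leq_addl.
have ub : bnd u C by have := uSb 0%N; rewrite subr0 mulr1.
exists u => //; apply/eqP; rewrite -subr_eq0; apply/eqP.
apply: bnd_eq0 => e e0; have [n /ltW ne] := geometric_small (C + C) q01 e0.
apply: bndW ne _.
have -> : u - (g + Phi u) = (u - S_ n.+1) - Phi (u - S_ n).
  rewrite PhiB//; last by exists C.
  have -> : S_ n.+1 = g + Phi (S_ n) by [].
  by apply/funext => x; rewrite !fctE; ring.
rewrite mulrDl; apply: bndB.
  apply: bndW (uSb n.+1); rewrite ler_wpM2l// q_anti//.
apply: bndW (Phi_bnd (uSb n)).
by rewrite ler_piMl ?mulr_ge0 ?exprn_ge0// ltW.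
Qed.

End Contraction.
End SquareSummable.

(** * Symmetric finite-range operators *)

Section SymmetricOperators.
Variables (R : realType) (I : choiceType) (D : set I).
Implicit Types (f g h u v : I -> R) (s t : seq I) (a c e k : R).
Notation bnd := (@bnd R I D).
Notation isl2 := (@isl2 R I D).
Notation onD := (@onD R I D).

Definition vanish_off f s := forall x, x \notin s -> f x = 0.

Definition fs f := onD f /\ exists s, vanish_off f s.

(** The sum is 0 by convention when infinitely many terms are nonzero, so this is the inner product
    only if one argument is finitely supported. *)
Definition dot f g : R := \sum_(x \in [set: I]) f x * g x.

Lemma fsumE s (F : I -> R) : uniq s -> (forall x, x \notin s -> F x = 0) ->
  \sum_(x \in [set: I]) F x = \sum_(x <- s) F x.
Proof.
move=> us Fs; rewrite [RHS]fsbig_seq// (fsbig_widen [set` s] setT)//.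
by move=> x [_ /= /negP /Fs].
Qed.

Lemma vanish_off_sub f s t : {subset s <= t} -> vanish_off f s -> vanish_off f t.
Proof. by move=> st fs x xt; apply: fs; apply: contra xt => /st. Qed.

Lemma common_support f g h : fs f -> fs g -> fs h ->
  exists s, [/\ uniq s, vanish_off f s, vanish_off g s & vanish_off h s].
Proof.
move=> [_ [s1 f1]] [_ [s2 g2]] [_ [s3 h3]]; exists (undup (s1 ++ s2 ++ s3)).
split; first exact: undup_uniq.
- by apply: vanish_off_sub f1 => x xs; rewrite mem_undup !mem_cat xs.
- by apply: vanish_off_sub g2 => x xs; rewrite mem_undup !mem_cat xs orbT.
- by apply: vanish_off_sub h3 => x xs; rewrite mem_undup !mem_cat xs !orbT.
Qed.

Lemma dotE f g s : uniq s -> vanish_off f s -> dot f g = \sum_(x <- s) f x * g x.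
Proof. by move=> us f0; apply: fsumE => // x /f0 ->; rewrite mul0r. Qed.

Lemma dot_sumsq f s : uniq s -> vanish_off f s -> dot f f = sumsq f s.
Proof. by move=> us f0; rewrite (@dotE _ _ s). Qed.

Lemma dotC f g : dot f g = dot g f.
Proof. by apply: eq_fsbigr => x _; rewrite mulrC. Qed.

Lemma fs_lin a f g : fs f -> fs g -> fs (a *: f + g).
Proof.
move=> ff fg; have [s [us f0 g0 _]] := common_support ff fg fg.
split; last by exists s => x xs; rewrite !fctE f0// g0// scaler0 addr0.
by move=> x Dx; rewrite !fctE (ff.1 _ Dx) (fg.1 _ Dx) scaler0 addr0.
Qed.

Lemma fsD f g : fs f -> fs g -> fs (f + g).
Proof. by move=> ff fg; rewrite -[f]scale1r; apply: fs_lin. Qed.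

Lemma fs0 : fs 0. Proof. by split => [//|]; exists [::]. Qed.

Lemma fsZ a f : fs f -> fs (a *: f).
Proof. by move=> ff; rewrite -[a *: f]addr0; apply: fs_lin => //; apply: fs0. Qed.

Lemma fsB f g : fs f -> fs g -> fs (f - g).
Proof. by move=> ff fg; rewrite -scaleN1r addrC; apply: fs_lin. Qed.

Lemma dot_lin a f g h : fs f -> fs g -> dot (a *: f + g) h = a * dot f h + dot g h.
Proof.
move=> ff fg; have [s [us f0 g0 _]] := common_support ff fg fg.
rewrite !(@dotE _ _ s)//; last by move=> x xs; rewrite !fctE f0// g0// scaler0 addr0.
rewrite mulr_sumr -big_split/=; apply: eq_bigr => x _.
by rewrite !fctE mulrDl mulrA.
Qed.

Lemma dotZl a f h : fs f -> dot (a *: f) h = a * dot f h.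
Proof.
move=> ff; rewrite -[a *: f]addr0 dot_lin//; last exact: fs0.
by rewrite (@dotE 0 _ [::])// big_nil addr0.
Qed.

Lemma dotDl f g h : fs f -> fs g -> dot (f + g) h = dot f h + dot g h.
Proof. by move=> ff fg; rewrite -[f]scale1r dot_lin// mul1r scale1r. Qed.

Lemma dotBl f g h : fs f -> fs g -> dot (f - g) h = dot f h - dot g h.
Proof. by move=> ff fg; rewrite addrC -scaleN1r dot_lin// mulN1r addrC. Qed.

Lemma dot_ge0 f : 0 <= dot f f.
Proof. by apply: fsumr_ge0 => x _; rewrite -expr2 sqr_ge0. Qed.

Lemma dot_bnd f c : fs f -> 0 <= c -> dot f f <= c ^+ 2 -> bnd f c.
Proof.
move=> [f0 [s sf]] c0 fc; split=> // t ut; apply: le_trans fc.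
rewrite (@dot_sumsq f (undup (s ++ t))) ?undup_uniq//; last first.
  by apply: vanish_off_sub sf => x xs; rewrite mem_undup mem_cat xs.
have tst : {subset t <= undup (s ++ t)}.
  by move=> x xt; rewrite mem_undup mem_cat xt orbT.
rewrite /sumsq [leRHS](bigID (mem t))/= -[leLHS]addr0 lerD//; last first.
  by apply: sumr_ge0 => x _; exact: sqr_ge0.
rewrite -[leRHS]big_filter le_eqVlt; apply/orP; left; apply/eqP; apply: perm_big.
apply: uniq_perm => //; first by rewrite filter_uniq// undup_uniq.
by move=> x; rewrite mem_filter/=; case: (boolP (x \in t)) => // /tst ->.
Qed.

Lemma bnd_dot f c : bnd f c -> fs f -> dot f f <= c ^+ 2.
Proof.
move=> [_ _ fc] [_ [s sf]]; rewrite (@dot_sumsq f (undup s)) ?undup_uniq ?fc ?undup_uniq//.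
by apply: vanish_off_sub sf => x; rewrite mem_undup.
Qed.

Lemma fs_isl2 f : fs f -> isl2 f.
Proof.
move=> ff; exists (dot f f + 1); apply: dot_bnd => //.
  by rewrite addr_ge0 ?dot_ge0.
by have := dot_ge0 f; nra.
Qed.

Definition restrict f s x : R := if x \in s then f x else 0.

Lemma fs_restrict f s : onD f -> fs (restrict f s).
Proof.
move=> f0; split; last by exists s => x /negbTE xs; rewrite /restrict xs.
by move=> x Dx; rewrite /restrict f0// if_same.
Qed.

Lemma bnd_restrict f s c : bnd f c -> bnd (restrict f s) c.
Proof.
move=> fc; rewrite -[c]mul1r.
have -> : restrict f s = (fun x => (x \in s)%:R * f x).
  by apply/funext => x; rewrite /restrict; case: ifP; rewrite ?mul1r ?mul0r.
by apply: bndM => // x _; case: (x \in s); rewrite ?normr1 ?normr0.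
Qed.

(** Take [s] whose sum of squares is within [e ^+ 2] of the supremum: a list disjoint from [s] can
    add no more than that. *)
Lemma bnd_tail f e : isl2 f -> 0 < e -> exists s, bnd (f - restrict f s) e.
Proof.
move=> [c [f0 c0 fc]] e0.
pose E := [set sumsq f s | s in [set s | uniq s]].
have Eub : has_sup E.
  split; first by exists (sumsq f [::]), [::].
  by exists (c ^+ 2) => _ [s us <-]; exact: fc.
have [_ [s us <-] ltS] := sup_adherent (exprn_gt0 2 e0) Eub.
exists s; split; [|exact: ltW|].
  by move=> x Dx; rewrite !fctE /restrict f0// if_same subr0.
move=> t ut; pose t' := [seq x <- t | x \notin s].
have -> : sumsq (f - restrict f s) t = sumsq f t'.
  rewrite /sumsq big_filter [RHS]big_mkcond; apply: eq_bigr => x _.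
  by rewrite !fctE /restrict; case: (x \in s); rewrite /= ?subrr ?expr0n ?subr0.
have : sumsq f (s ++ t') <= sup E.
  apply: ub_le_sup; first exact: Eub.2.
  exists (s ++ t') => //=; rewrite cat_uniq us filter_uniq// andbT/=.
  by apply/hasPn => x; rewrite mem_filter => /andP[].
rewrite /sumsq big_cat/= -!/(sumsq _ _); move: ltS; lra.
Qed.

(* Finite-range operators that are symmetric on finitely supported functions. *)
Record good (T : (I -> R) -> I -> R) : Prop := Good {
  good_lin : forall a f g, T (a *: f + g) = a *: T f + T g;
  good_loc : forall x, exists s, forall f, {in s, forall y, f y = 0} -> T f x = 0;
  good_onD : forall f, onD f -> onD (T f);
  good_fs : forall f, fs f -> fs (T f);
  good_sym : forall f g, fs f -> fs g -> dot (T f) g = dot f (T g) }.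

Implicit Types T : (I -> R) -> I -> R.

Lemma goodD T f g : good T -> T (f + g) = T f + T g.
Proof. by move=> gT; rewrite -[f]scale1r (good_lin gT) !scale1r. Qed.

Lemma good0 T : good T -> T 0 = 0.
Proof.
by move=> gT; apply: (addrI (T 0)); rewrite addr0 -(goodD _ _ gT) addr0.
Qed.

Lemma goodZ T a f : good T -> T (a *: f) = a *: T f.
Proof. by move=> gT; rewrite -[a *: f]addr0 (good_lin gT) (good0 gT) addr0. Qed.

Lemma goodB T f g : good T -> T (f - g) = T f - T g.
Proof. by move=> gT; rewrite -scaleN1r addrC (good_lin gT) scaleN1r addrC. Qed.

Lemma good_loc_seq T s : good T ->
  exists t, forall f, {in t, forall y, f y = 0} -> {in s, forall x, T f x = 0}.
Proof.
move=> gT; elim: s => [|x s [t IH]]; first by exists [::].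
have [r H] := good_loc gT x; exists (r ++ t) => f f0 y.
rewrite inE => /orP[/eqP ->|ys].
  by apply: H => z zr; apply: f0; rewrite mem_cat zr.
by apply: IH ys => z zt; apply: f0; rewrite mem_cat zt orbT.
Qed.

Lemma good_lincomb T1 T2 a : good T1 -> good T2 -> good (fun f => T1 f + a *: T2 f).
Proof.
move=> g1 g2; split.
- move=> b f g; rewrite (good_lin g1) (good_lin g2).
  by apply/funext => x; rewrite !fctE /GRing.scale/=; ring.
- move=> x; have [s1 H1] := good_loc g1 x; have [s2 H2] := good_loc g2 x.
  exists (s1 ++ s2) => f f0; rewrite !fctE H1 ?H2 ?scaler0 ?addr0// => y ys;
  by apply: f0; rewrite mem_cat ys ?orbT.
- move=> f f0 x Dx.
  by rewrite !fctE (good_onD g1 f0 Dx) (good_onD g2 f0 Dx) scaler0 addr0.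
- by move=> f ff; apply: fsD; [apply: good_fs|apply/fsZ/good_fs].
- move=> f g ff fg; have f1 := good_fs g1 ff; have f2 := good_fs g2 ff.
  have h1 := good_fs g1 fg; have h2 := good_fs g2 fg.
  rewrite dotDl ?dotZl//; last exact: fsZ.
  rewrite [RHS]dotC dotDl ?dotZl//; last exact: fsZ.
  by rewrite (good_sym g1)// (good_sym g2)// dotC [in X in _ + X]dotC.
Qed.

Lemma good_id : good id.
Proof. by split=> // x; exists [:: x] => f; apply; rewrite inE. Qed.

Lemma good_sqr T : good T -> good (fun f => T (T f)).
Proof.
move=> gT; split.
- by move=> a f g; rewrite !(good_lin gT).
- move=> x; have [s H] := good_loc gT x; have [t H'] := good_loc_seq s gT.
  by exists t => f /H' H''; apply: H.
- by move=> f f0; do 2 apply: (good_onD gT).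
- by move=> f ff; do 2 apply: (good_fs gT).
- move=> f g ff fg; rewrite !(good_sym gT)//; apply: (good_fs gT) => //.
Qed.

Definition sub_scalar T c f := T f - c *: f.

Lemma good_sub_scalar T c : good T -> good (sub_scalar T c).
Proof.
move=> gT; have := good_lincomb (- c) gT good_id.
by congr good; apply/funext => f; rewrite scaleNr.
Qed.

(* Polarization: [4 <Tf, g> = <T(f+g), f+g> - <T(f-g), f-g>] with [g = Tf / k]. *)
Lemma numerical_range_bound T k : good T -> 0 < k ->
  (forall f, fs f -> `|dot (T f) f| <= k * dot f f) ->
  forall f, fs f -> dot (T f) (T f) <= k ^+ 2 * dot f f.
Proof.
move=> gT k0 H f ff; have fT := good_fs gT ff.
pose g := k^-1 *: T f; have fg : fs g by apply: fsZ.
have fTg := good_fs gT fg.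
have := H _ (fsD ff fg); have := H _ (fsB ff fg).
rewrite (goodD f g gT) (goodB f g gT) !dotBl ?dotDl//.
rewrite ![dot _ (f - g)]dotC ![dot _ (f + g)]dotC !dotBl ?dotDl//.
rewrite ![dot _ (T g)]dotC (good_sym gT fg ff).
have -> : dot f (T f) = dot (T f) f by rewrite dotC.
have -> : dot g f = dot f g by rewrite dotC.
have gE : dot g (T f) = k^-1 * dot (T f) (T f) by rewrite dotZl.
have ggE : dot g g = k^-1 * (k^-1 * dot (T f) (T f)).
  by rewrite dotZl// dotC dotZl.
rewrite gE ggE.
set F := dot f f; set N := dot (T f) (T f).
rewrite !ler_norml => /andP[h1 h2] /andP[h3 h4].
have h : 4 * (k^-1 * N) <= k * (2 * F + 2 * (k^-1 * (k^-1 * N))) by lra.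
have E : k * (2 * F + 2 * (k^-1 * (k^-1 * N))) = 2 * k * F + 2 * (k^-1 * N).
  by field; rewrite gt_eqF.
rewrite E in h.
have {}h : k^-1 * N <= k * F by lra.
by rewrite mulrC ler_pdivrMr// in h; rewrite expr2 -mulrA mulrC; lra.
Qed.

(** The form of [T - k / 2] is bounded by [k / 2], hence so is its norm; expanding the square of
    that norm bound gives the claim, which is T^2 <= k T. *)
Lemma nonneg_form_bound T k : good T -> 0 < k ->
  (forall f, fs f -> 0 <= dot (T f) f <= k * dot f f) ->
  forall f, fs f -> dot (T f) (T f) <= k * dot (T f) f.
Proof.
move=> gT k0 H f ff; have k2 : 0 < k / 2 by rewrite divr_gt0.
have fE h : fs h -> dot (sub_scalar T (k / 2) h) h = dot (T h) h - k / 2 * dot h h.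
  by move=> fh; rewrite dotBl ?dotZl//; [exact: good_fs|exact: fsZ].
have NR h : fs h -> `|dot (sub_scalar T (k / 2) h) h| <= k / 2 * dot h h.
  move=> fh; rewrite fE// ler_norml; have /andP[? ?] := H _ fh.
  by apply/andP; split; lra.
have := numerical_range_bound (good_sub_scalar (k / 2) gT) k2 NR ff.
have fT := good_fs gT ff; have fk := fsZ (k / 2) ff.
rewrite dotBl// ![dot _ (sub_scalar _ _ _)]dotC !dotBl// !dotZl//.
rewrite ![dot _ (_ *: _)]dotC !dotZl// (dotC f (T f)).
lra.
Qed.

(** By finite range, the values of [T f] on a finite list depend only on a finite truncation of [f],
    whose norm is no larger than that of [f]. *)
Lemma fs_bnd_extend T k : good T -> 0 <= k ->
  (forall f, fs f -> dot (T f) (T f) <= k ^+ 2 * dot f f) ->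
  forall f c, bnd f c -> bnd (T f) (k * c).
Proof.
move=> gT k0 H f c fc; have [f0 c0 _] := fc.
split; [exact: (good_onD gT)|exact: mulr_ge0|move=> s us].
have [t Ht] := good_loc_seq s gT.
have fr : fs (restrict f t) by apply: fs_restrict.
have -> : sumsq (T f) s = sumsq (T (restrict f t)) s.
  apply: eq_sumsq => x xs; apply/eqP; rewrite -subr_eq0; apply/eqP.
  have -> : T f x - T (restrict f t) x = (T f - T (restrict f t)) x by [].
  rewrite -(goodB _ _ gT); apply: Ht xs => y yt.
  by rewrite !fctE /restrict yt subrr.
have : bnd (T (restrict f t)) (k * c).
  apply: dot_bnd; [exact: (good_fs gT)|exact: mulr_ge0|].
  apply: le_trans (H _ fr) _; rewrite exprMn ler_wpM2l ?sqr_ge0//.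
  exact: bnd_dot (bnd_restrict t fc) fr.
by case=> _ _; apply.
Qed.

Lemma fs_lower_extend T K k : good T -> 0 < k -> 0 <= K ->
  (forall f c, bnd f c -> bnd (T f) (K * c)) ->
  (forall f, fs f -> k ^+ 2 * dot f f <= dot (T f) (T f)) ->
  forall f a, isl2 f -> bnd (T f) a -> bnd f (a / k).
Proof.
move=> gT k0 K0 TK H f a lf Ta; apply: bnd_le => e e0.
have KK : 0 < K / k + 1 by rewrite ltr_wpDl// divr_ge0// ltW.
(* Chosen so that [(a + K * d) / k + d = a / k + e]: the tail is paid for once through [T] and once
   directly. *)
pose d := e / (K / k + 1); have d0 : 0 < d by rewrite divr_gt0.
have [s fsd] := bnd_tail lf d0; set g := restrict f s in fsd.
have [c [f0 _ _]] := lf; have fg : fs g by apply: fs_restrict.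
have Tg : bnd (T g) (a + K * d).
  have -> : T g = T f - T (f - g).
    by rewrite -(goodB _ _ gT) opprB addrC subrK.
  by apply: bndB => //; apply: TK.
have gb : bnd g ((a + K * d) / k).
  have b0 := bnd_ge0 Tg; apply: dot_bnd => //; first by rewrite divr_ge0// ltW.
  rewrite expr_div_n ler_pdivlMr ?exprn_gt0// mulrC.
  by apply: le_trans (H _ fg) _; apply: bnd_dot Tg (good_fs gT fg).
have -> : f = g + (f - g) by rewrite addrC subrK.
have -> : a / k + e = (a + K * d) / k + d; last exact: bndD.
by rewrite /d; field; rewrite ?gt_eqF//; move: KK; rewrite -(ltr_pM2r k0); nra.
Qed.

(* [m] is an approximate eigenvalue of [T] along finitely supported functions. *)
Definition apxev T m :=
  forall c, 0 < c -> exists2 f, fs f &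
    dot (sub_scalar T m f) (sub_scalar T m f) < c * dot f f.

Lemma lower_edge T K : good T -> (exists2 f, fs f & 0 < dot f f) -> 0 <= K ->
  (forall f, fs f -> 0 <= dot (T f) f <= K * dot f f) ->
  exists m, [/\ 0 <= m, forall f, fs f -> m * dot f f <= dot (T f) f & apxev T m].
Proof.
move=> gT [f1 ff1 f1_gt0] K0 H.
pose E := [set r : R | forall f, fs f -> r * dot f f <= dot (T f) f].
have E0 : E 0 by move=> f /H /andP[]; rewrite mul0r.
have Eub : has_ubound E.
  exists K => r /(_ _ ff1) /le_trans - /(_ (K * dot f1 f1)).
  by rewrite ler_pM2r//; apply; case/andP: (H _ ff1).
have mE f : fs f -> sup E * dot f f <= dot (T f) f.
  move=> ff; have [f0|f_neq0] := eqVneq (dot f f) 0.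
    by rewrite f0 mulr0; case/andP: (H _ ff).
  have f0 : 0 < dot f f by rewrite lt_neqAle eq_sym f_neq0 dot_ge0.
  rewrite -ler_pdivlMr//; apply: ge_sup; first by exists 0.
  by move=> r /(_ _ ff); rewrite ler_pdivlMr.
have m0 : 0 <= sup E by apply: ub_le_sup.
exists (sup E); split=> // c c0.
have K1 : 0 < K + 1 by rewrite ltr_wpDl.
have [f [ff fE]] : exists f, fs f /\
    dot (T f) f < (sup E + c / (K + 1)) * dot f f.
  apply: contrapT => /forallNP nE.
  have : E (sup E + c / (K + 1)).
    by move=> f ff; rewrite leNgt; apply/negP => h; apply: (nE f).
  move=> /(ub_le_sup Eub); apply/negP; rewrite -ltNge ltrDl.
  by rewrite divr_gt0.
exists f => //; have gS := good_sub_scalar (sup E) gT.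
have SE g : fs g -> dot (sub_scalar T (sup E) g) g = dot (T g) g - sup E * dot g g.
  by move=> fg; rewrite dotBl ?dotZl//; [exact: good_fs|exact: fsZ].
apply: le_lt_trans (nonneg_form_bound gS K1 _ ff) _.
  move=> g fg; rewrite SE// subr_ge0 mE//=.
  have := dot_ge0 g; have /andP[] := H _ fg; nra.
rewrite SE//.
have -> : c * dot f f = (K + 1) * (c / (K + 1) * dot f f).
  by field; rewrite gt_eqF.
by rewrite ltr_pM2l//; lra.
Qed.

(* [P = 1 - T^2 / M] has numerical range in [0, q] with q < 1, so [T^2] is
   inverted by a Neumann series and [T (T^2)^-1] inverts [T]. *)
Lemma bounded_below_solve T K c : good T -> 0 <= K -> 0 < c ->
  (forall f, fs f -> dot (T f) (T f) <= K ^+ 2 * dot f f) ->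
  (forall f, fs f -> c * dot f f <= dot (T f) (T f)) ->
  exists C, [/\ 0 <= C,
    forall g a, bnd g a -> exists2 v, bnd v (C * a) & T v = g &
    forall u, isl2 u -> T u = 0 -> u = 0].
Proof.
move=> gT K0 c0 HK Hc.
(* Larger than [K ^+ 2], which makes the form of [P] nonnegative, and larger than [c], which makes
   [q] positive. *)
pose M := K ^+ 2 + c + 1.
have M0 : 0 < M by rewrite /M; have := sqr_ge0 K; lra.
pose q := 1 - c / M.
have qlt1 : q < 1 by rewrite /q ltrBlDr ltrDl divr_gt0.
have q_gt0 : 0 < q.
  by rewrite /q subr_gt0 ltr_pdivrMr// mul1r /M; have := sqr_ge0 K; lra.
have q01 : 0 <= q < 1 by rewrite (ltW q_gt0).
pose P f := f + (- M^-1) *: T (T f).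
have gP : good P by apply: good_lincomb; [exact: good_id|exact: good_sqr].
have PE f : fs f -> dot (P f) f = dot f f - M^-1 * dot (T f) (T f).
  move=> ff; have fT := good_fs gT ff; have fTT := good_fs gT fT.
  rewrite dotDl ?dotZl//; last exact: fsZ.
  by rewrite (good_sym gT fT ff) mulNr.
have Pq : forall f a, bnd f a -> bnd (P f) (q * a).
  apply: (fs_bnd_extend gP); first exact: ltW.
  apply: numerical_range_bound => // f ff; rewrite PE//.
  have TM : M^-1 * dot (T f) (T f) <= dot f f.
    rewrite mulrC ler_pdivrMr//; apply: le_trans (HK _ ff) _.
    by rewrite mulrC ler_wpM2l ?dot_ge0// /M; lra.
  have cM : c / M * dot f f <= M^-1 * dot (T f) (T f).
    by rewrite mulrAC [leLHS]mulrC ler_pM2l ?invr_gt0// Hc.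
  by rewrite ger0_norm ?subr_ge0// /q; lra.
have PB f g : isl2 f -> isl2 g -> P (f - g) = P f - P g.
  by move=> _ _; apply: goodB.
have TK := fs_bnd_extend gT K0 HK.
exists (K * (M^-1 / (1 - q))); split.
- by rewrite !mulr_ge0 ?invr_ge0 ?subr_ge0// ltW.
- move=> g a ga; have := bndZ M^-1 ga.
  rewrite ger0_norm ?invr_ge0 ?(ltW M0)// => /(contraction_solve q01 PB Pq).
  case=> u ub uE; exists (T u).
    by have := TK _ _ ub; congr bnd; ring.
  have : M^-1 *: T (T u) = M^-1 *: g.
    apply/eqP; rewrite -subr_eq0 -oppr_eq0 opprB; apply/eqP.
    apply: (addrI u); rewrite addr0 [RHS]uE /P scaleNr.
    by apply/funext => x; rewrite !fctE; ring.
  by move=> /(congr1 (fun h => M *: h)); rewrite !scalerA divff ?gt_eqF// !scale1r.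
- move=> u lu u0; apply: (contraction_fix0 q01 Pq) => //.
  by rewrite /P u0 (good0 gT) scaler0 addr0.
Qed.

End SymmetricOperators.

(** * The Laplacian as a sum over triangles *)

Section LatticeLaplacian.
Variable R : realType.
Implicit Types (f g : pt -> R) (t x y v : pt).
Notation fs := (@fs R _ G).

Definition tau t : R := if `[< base t >] then 1 else 0.

Definition tsum f t : R := f t + f (t.1 + 1, t.2) + f (t.1, t.2 + 1).

Definition gap f t x : R := tau t * (3 * f x - tsum f t).

(* [- lap], written as a sum over the (at most two) triangles containing [x] *)
Definition negLap f x : R :=
  gap f x x + gap f (x.1 - 1, x.2) x + gap f (x.1, x.2 - 1) x.

Lemma tau_ge0 t : 0 <= tau t. Proof. by rewrite /tau; case: ifP. Qed.

Lemma tau_off x : ~ G x ->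
  [/\ tau x = 0, tau (x.1 - 1, x.2) = 0 & tau (x.1, x.2 - 1) = 0].
Proof.
move=> Gx; have H t : tri t x -> tau t = 0.
  move=> tx; rewrite /tau; case: asboolP => // bt; case: Gx.
  by apply/GE; exists t.
by split; apply: H; apply/triE; [apply: Or31|apply: Or32|apply: Or33].
Qed.

(** The six nearest neighbours in the ambient triangular lattice, adjacent or not: a fixed index
    list for the Laplacian. *)
Definition nbrs x : seq pt := [:: (x.1 + 1, x.2); (x.1, x.2 + 1); (x.1 - 1, x.2);
  (x.1 - 1, x.2 + 1); (x.1, x.2 - 1); (x.1 + 1, x.2 - 1)].

Lemma nbrs_sym x y : y \in nbrs x -> x \in nbrs y.
Proof.
case: x y => a b [i j]; rewrite !inE !xpair_eqE /=; lia.
Qed.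

Lemma nbrs_uniq x : uniq (nbrs x).
Proof. by case: x => a b; rewrite /= !inE !xpair_eqE; lia. Qed.

Lemma adj_nbrs x y : adj x y -> y \in nbrs x.
Proof.
move=> /adjE [xy [t [_ /triE tx /triE ty]]]; move: x y t xy tx ty.
move=> [a b] [c d] [i j] xy tx ty.
have : ~~ ((a == c) && (b == d)).
  by apply/negP => /andP[/eqP ac /eqP bd]; apply: xy; rewrite ac bd.
rewrite !inE !xpair_eqE /=.
by case: tx => -[]; case: ty => -[]; lia.
Qed.

(** When only one upright triangle contains both points, their adjacency is decided by whether that
    triangle belongs to the lattice. *)
Lemma adj_tau x y t : tri t x -> tri t y -> x <> y ->
  (forall t', tri t' x -> tri t' y -> t' = t) ->
  (if y \in [set y | adj x y] then 1 else 0) = tau t.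
Proof.
move=> tx ty xy ut; rewrite /tau.
have -> : (y \in [set y | adj x y]) = `[< base t >]; last by [].
apply/idP/idP => [|/asboolP bt].
  rewrite inE => /adjE [_ [t' [bt' tx' ty']]]; apply/asboolP.
  by rewrite -(ut t').
by rewrite inE; apply/adjE; split=> //; exists t.
Qed.

(** Each of the six neighbours shares exactly one upright triangle with [x], and each of the three
    triangles at [x] accounts for two of them. Its two differences add up to
    [3 * f x - tsum f t]. *)
Lemma negLapE f x : - lap f x = negLap f x.
Proof.
rewrite /lap fsbig_mkcond (@fsumE _ _ (nbrs x)) ?nbrs_uniq//; last first.
  move=> y yx; rewrite /patch; case: ifPn => //; rewrite inE => /adj_nbrs.
  by rewrite (negbTE yx).
have pE y t : tri t x -> tri t y -> x <> y ->
    (forall t', tri t' x -> tri t' y -> t' = t) ->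
    patch (fun=> 0) [set y | adj x y] (fun y => f y - f x) y = tau t * (f y - f x).
  by move=> *; rewrite -(@adj_tau x y t)// /patch; case: ifP;
     rewrite ?mul1r ?mul0r.
case: x pE => a b pE; rewrite /nbrs !big_cons big_nil /=.
rewrite (@pE (a + 1, b) (a, b)); first last.
- move=> [i j] /triE h1 /triE h2; rewrite /= in h1 h2.
  by case: h1 => -[? ?]; case: h2 => -[? ?]; congr pair; lia.
- by case; lia.
- by apply/triE; apply: Or32 => /=; congr pair; lia.
- by apply/triE; apply: Or31.
rewrite (@pE (a, b + 1) (a, b)); first last.
- move=> [i j] /triE h1 /triE h2; rewrite /= in h1 h2.
  by case: h1 => -[? ?]; case: h2 => -[? ?]; congr pair; lia.
- by case; lia.
- by apply/triE; apply: Or33 => /=; congr pair; lia.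
- by apply/triE; apply: Or31.
rewrite (@pE (a - 1, b) (a - 1, b)); first last.
- move=> [i j] /triE h1 /triE h2; rewrite /= in h1 h2.
  by case: h1 => -[? ?]; case: h2 => -[? ?]; congr pair; lia.
- by case; lia.
- by apply/triE; apply: Or31.
- by apply/triE; apply: Or32.
rewrite (@pE (a - 1, b + 1) (a - 1, b)); first last.
- move=> [i j] /triE h1 /triE h2; rewrite /= in h1 h2.
  by case: h1 => -[? ?]; case: h2 => -[? ?]; congr pair; lia.
- by case; lia.
- by apply/triE; apply: Or33 => /=; congr pair; lia.
- by apply/triE; apply: Or32.
rewrite (@pE (a, b - 1) (a, b - 1)); first last.
- move=> [i j] /triE h1 /triE h2; rewrite /= in h1 h2.
  by case: h1 => -[? ?]; case: h2 => -[? ?]; congr pair; lia.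
- by case; lia.
- by apply/triE; apply: Or31.
- by apply/triE; apply: Or33.
rewrite (@pE (a + 1, b - 1) (a, b - 1)); first last.
- move=> [i j] /triE h1 /triE h2; rewrite /= in h1 h2.
  by case: h1 => -[? ?]; case: h2 => -[? ?]; congr pair; lia.
- by case; lia.
- by apply/triE; apply: Or32 => /=; congr pair; lia.
- by apply/triE; apply: Or33.
by rewrite /negLap /gap /tsum /= !subrK; ring.
Qed.

Lemma HopE (V : pt -> R) f x : onD G f -> Hop V f x = negLap f x + V x * f x.
Proof.
move=> f0; rewrite /Hop negLapE; case: asboolP => // Gx.
have [t1 t2 t3] := tau_off Gx.
by rewrite /negLap /gap t1 t2 t3 f0// !mul0r !add0r mulr0.
Qed.

(** Both sides sum over incident pairs (triangle, vertex). Each of the three positions of a vertex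
    in its triangle is reindexed by a translation. *)
Lemma vertex_triangle_sum (k : pt -> pt -> R) (s : seq pt) : (forall t x, x \notin s -> k t x = 0) ->
  \sum_(x \in [set: pt]) (k x x + k (x.1 - 1, x.2) x + k (x.1, x.2 - 1) x) =
  \sum_(t \in [set: pt]) (k t t + k t (t.1 + 1, t.2) + k t (t.1, t.2 + 1)).
Proof.
move=> ks; pose s1 := [seq (x.1 - 1, x.2) | x <- s].
pose s2 := [seq (x.1, x.2 - 1) | x <- s].
pose S0 := undup (s ++ s1 ++ s2).
have uS : uniq S0 by exact: undup_uniq.
have sub0 : {subset s <= S0} by move=> x xs; rewrite mem_undup !mem_cat xs.
have k0 t x : x \notin S0 -> k t x = 0 by move=> xS; apply: ks; apply: contra xS => /sub0.
have k1 t : t \notin S0 -> k t (t.1 + 1, t.2) = 0.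
  move=> tS; apply: ks; apply: contra tS => /(map_f (fun x => (x.1 - 1, x.2))).
  by rewrite /= addrK -surjective_pairing mem_undup !mem_cat => ->; rewrite orbT.
have k2 t : t \notin S0 -> k t (t.1, t.2 + 1) = 0.
  move=> tS; apply: ks; apply: contra tS => /(map_f (fun x => (x.1, x.2 - 1))).
  by rewrite /= addrK -surjective_pairing mem_undup !mem_cat => ->; rewrite !orbT.
rewrite !(@fsumE _ _ S0)//; last first.
- by move=> x xS; rewrite !k0// !addr0.
- by move=> x xS; rewrite k0// k1// k2// !addr0.
rewrite !big_split/=; congr (_ + _ + _).
- rewrite -(@fsumE _ _ S0 (fun x => k (x.1 - 1, x.2) x))//; last by move=> x; exact: k0.
  rewrite -(@fsumE _ _ S0 (fun t => k t (t.1 + 1, t.2)))//.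
  rewrite (@reindex_fsbigT _ _ _ _ _ (fun t : pt => (t.1 + 1, t.2))) /=; last first.
    exists (fun x : pt => (x.1 - 1, x.2)) => -[a b] /=; first by rewrite addrK.
    by rewrite subrK.
  by apply: eq_fsbigr => -[a b] _ /=; rewrite addrK.
- rewrite -(@fsumE _ _ S0 (fun x => k (x.1, x.2 - 1) x))//; last by move=> x; exact: k0.
  rewrite -(@fsumE _ _ S0 (fun t => k t (t.1, t.2 + 1)))//.
  rewrite (@reindex_fsbigT _ _ _ _ _ (fun t : pt => (t.1, t.2 + 1))) /=; last first.
    exists (fun x : pt => (x.1, x.2 - 1)) => -[a b] /=; first by rewrite addrK.
    by rewrite subrK.
  by apply: eq_fsbigr => -[a b] _ /=; rewrite addrK.
Qed.

(** The factor after [tau t] equals the sum of [(f x - f y) * (g x - g y)] over the three edges of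
    the triangle, so this is the Dirichlet form of one triangle. *)
Definition tform f g t : R :=
  tau t * (3 * (f t * g t + f (t.1 + 1, t.2) * g (t.1 + 1, t.2) +
                f (t.1, t.2 + 1) * g (t.1, t.2 + 1)) - tsum f t * tsum g t).

Lemma dot_negLap f g : fs f -> fs g ->
  dot (negLap f) g = \sum_(t \in [set: pt]) tform f g t.
Proof.
move=> ff [_ [s gs]].
have := @vertex_triangle_sum (fun t x => gap f t x * g x) s.
move=> /(_ _)/wrap[t x xs|H]; first by rewrite gs// mulr0.
transitivity (\sum_(x \in [set: pt])
  (gap f x x * g x + gap f (x.1 - 1, x.2) x * g x + gap f (x.1, x.2 - 1) x * g x)).
  by apply: eq_fsbigr => x _; rewrite /negLap !mulrDl.
rewrite H; apply: eq_fsbigr => t _; rewrite /gap /tform /tsum; ring.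
Qed.

Lemma good_negLap : good G negLap.
Proof.
split.
- move=> a f g; apply/funext => x.
  by rewrite !fctE /negLap /gap /tsum /= /GRing.scale /=; ring.
- move=> [a b]; exists ((a, b) :: nbrs (a, b)) => f f0.
  rewrite /negLap /gap /tsum /= !subrK.
  by rewrite !f0 ?inE ?eqxx ?orbT// !addr0 !mulr0 subrr !mulr0 !addr0.
- move=> f f0 x Dx; have [t1 t2 t3] := tau_off Dx.
  by rewrite /negLap /gap t1 t2 t3 !mul0r !addr0.
- move=> f [f0 [s fs]]; split.
    move=> x Dx; have [t1 t2 t3] := tau_off Dx.
    by rewrite /negLap /gap t1 t2 t3 !mul0r !addr0.
  exists (s ++ flatten [seq nbrs y | y <- s]) => -[a b] /=.
  rewrite mem_cat negb_or => /andP[xs /flatten_mapP xn].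
  have fy y : y \in nbrs (a, b) -> f y = 0.
    move=> yn; apply: fs; apply/negP => ys; apply: xn; exists y => //.
    exact: nbrs_sym.
  rewrite /negLap /gap /tsum /= !subrK fs//.
  by rewrite !fy ?inE ?eqxx ?orbT// !addr0 !mulr0 subrr !mulr0 !addr0.
- move=> f g ff fg; rewrite dotC dotC dot_negLap// dotC dot_negLap//.
  by apply: eq_fsbigr => t _; rewrite /tform; ring.
Qed.

(** The lower bound is a sum of squared differences over edges. For the upper one, [6 * dot f f]
    minus the form is at least the sum of [tau t * tsum f t ^+ 2], because at most two triangles
    meet at a vertex. *)
Lemma negLap_form f : fs f -> 0 <= dot (negLap f) f <= 6 * dot f f.
Proof.
move=> ff; rewrite dot_negLap//; apply/andP; split.
  apply: fsumr_ge0 => t _; rewrite /tform mulr_ge0 ?tau_ge0// /tsum.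
  set a := f t; set b := f _; set c := f _.
  have := sqr_ge0 (a - b); have := sqr_ge0 (b - c); have := sqr_ge0 (a - c); nra.
have [_ [s0 f0']] := ff; pose s := undup s0.
have f0 : vanish_off f s by apply: vanish_off_sub f0' => x; rewrite mem_undup.
have us : uniq s by exact: undup_uniq.
rewrite -dot_negLap// (dotC (negLap f)) !(@dotE _ _ _ _ s)//.
(* Distributes [tau t * tsum f t ^+ 2] over the three vertices of [t], so that the comparison can be
   made vertex by vertex. *)
pose k t x := tau t * f x * tsum f t.
pose K x := k x x + k (x.1 - 1, x.2) x + k (x.1, x.2 - 1) x.
have k0 t x : x \notin s -> k t x = 0 by move=> /f0 fx; rewrite /k fx mulr0 mul0r.
have : 0 <= \sum_(x <- s) K x.
  rewrite -fsumE//; last by move=> x xs; rewrite /K !k0// !addr0.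
  rewrite (vertex_triangle_sum k0); apply: fsumr_ge0 => t _.
  have -> : k t t + k t (t.1 + 1, t.2) + k t (t.1, t.2 + 1) = tau t * tsum f t ^+ 2.
    by rewrite /k /tsum; ring.
  by rewrite mulr_ge0 ?tau_ge0// sqr_ge0.
move=> K_ge0; rewrite -subr_ge0; apply: le_trans K_ge0 _.
rewrite mulr_sumr -sumrB; apply: ler_sum => x _.
have nx : tau x + tau (x.1 - 1, x.2) + tau (x.1, x.2 - 1) <= 2.
  have := @base_at_most_two x; rewrite /tau.
  by case: asboolP => h1; case: asboolP => h2; case: asboolP => h3 H;
     rewrite ?addr0 ?add0r//; try lra; case: (H h1 h2 h3).
rewrite /K /k /negLap /gap; have := sqr_ge0 (f x); nra.
Qed.

Lemma fs_nonzero : exists2 f, fs f & 0 < dot f f.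
Proof.
pose f (x : pt) : R := if x == (0, 0) then 1 else 0.
have f0 : vanish_off f [:: (0, 0)] by move=> x; rewrite inE /f => /negbTE ->.
exists f; last by rewrite (dotE _ _ f0)// big_seq1 /f eqxx mulr1.
split; last by exists [:: (0, 0)].
move=> x Gx; apply: f0; rewrite inE; apply/eqP => x0; apply: Gx; rewrite x0.
exact: G0.
Qed.

(** * Translations *)

Definition translate f v x : R := f (x.1 - v.1, x.2 - v.2).

(** Only triangles that meet the support of [f] have to match; on any other triangle both gaps
    vanish, whatever [tau] is. The equivalence is needed in both directions, since an additional
    triangle at the new place would change the operator. *)
Lemma negLap_translate f v x :
  (forall t y, tri t y -> f y != 0 -> base (padd t v) <-> base t) ->
  negLap (translate f v) x = translate (negLap f) v x.
Proof.
move=> H.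
have gapE y t : tri t y ->
    gap (translate f v) (padd t v) (padd y v) = gap f t y.
  move=> ty; rewrite /gap /tsum /translate /padd /= !addrK.
  have -> : t.1 + v.1 + 1 - v.1 = t.1 + 1 by lia.
  have -> : t.2 + v.2 + 1 - v.2 = t.2 + 1 by lia.
  rewrite -!surjective_pairing.
  have [nz|z] := pselect (exists y, tri t y /\ f y != 0).
    have [z [tz fz]] := nz; congr (_ * _); rewrite /tau.
    by congr (if _ then _ else _); apply/asbool_equiv_eq; apply: H fz.
  have f0 z' : tri t z' -> f z' = 0.
    by move=> tz; apply/eqP/negPn/negP => fz; apply: z; exists z'.
  have t0 : tri t t by apply/triE; apply: Or31.
  have t1 : tri t (t.1 + 1, t.2).
    by apply/triE; apply: Or32; rewrite /= addrK -surjective_pairing.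
  have t2 : tri t (t.1, t.2 + 1).
    by apply/triE; apply: Or33; rewrite /= addrK -surjective_pairing.
  by rewrite (f0 _ ty) (f0 _ t0) (f0 _ t1) (f0 _ t2) !addr0 mulr0 subrr !mulr0.
rewrite [RHS]/translate; set y := (x.1 - v.1, x.2 - v.2).
have xE : x = padd y v by case: (x) @y => a b; rewrite /padd /= !subrK.
rewrite /negLap.
have -> : (x.1 - 1, x.2) = padd (y.1 - 1, y.2) v.
  by rewrite xE /padd /=; congr pair; lia.
have -> : (x.1, x.2 - 1) = padd (y.1, y.2 - 1) v.
  by rewrite xE /padd /=; congr pair; lia.
rewrite xE !gapE//; apply/triE; [exact: Or33|exact: Or32|exact: Or31].
Qed.

End LatticeLaplacian.

(** * Spectrum of deterministic Schrodinger operators *)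

Section Spectrum.
Variable R : realType.
Implicit Types (f g u : pt -> R) (V : pt -> R) (x : pt) (a b c z lam : R).
Notation bnd := (@bnd R _ G).
Notation isl2 := (@isl2 R _ G).
Notation fs := (@fs R _ G).
Notation onG := (@onD R _ G).
Notation apxev := (@apxev R _ G).

Lemma nsq_bnd f c : bnd f c -> (nsq f <= (c ^+ 2)%:E)%E.
Proof.
move=> [_ _ H]; apply: ge_ereal_sup => _ [X [finX _] <-].
have [s us ->] : exists2 s : seq pt, uniq s & X = [set` s].
  move/finite_seqP: finX => [s ->]; exists (undup s); first exact: undup_uniq.
  by apply/seteqP; split=> x /=; rewrite mem_undup.
by rewrite -fsbig_seq// sumEFin lee_fin H.
Qed.

Lemma bnd_nsq f c : onG f -> 0 <= c -> (nsq f <= (c ^+ 2)%:E)%E -> bnd f c.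
Proof.
move=> f0 c0 H; split=> // s us; rewrite -lee_fin; apply: le_trans H.
pose t := [seq x <- s | `[< G x >]].
have -> : sumsq f s = sumsq f t.
  rewrite /sumsq big_filter [RHS]big_mkcond; apply: eq_bigr => x _.
  by case: asboolP => // Gx; rewrite f0// expr0n.
apply: ereal_sup_ubound; exists [set` t]; last first.
  by rewrite -fsbig_seq ?filter_uniq// sumEFin.
split; first exact: finite_seq.
by move=> x /=; rewrite mem_filter => /andP[/asboolP].
Qed.

Lemma l2_bnd f : l2 f ->
  exists c, [/\ 0 <= c, bnd f c & nsq f = (c ^+ 2)%:E].
Proof.
move=> [f0 flt].
have n0 : (0 <= nsq f)%E by apply: esum_ge0 => x _; rewrite lee_fin sqr_ge0.
have nfin : nsq f \is a fin_num by rewrite ge0_fin_numE.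
have E : nsq f = (Num.sqrt (fine (nsq f)) ^+ 2)%:E.
  by rewrite sqr_sqrtr ?fine_ge0// fineK.
exists (Num.sqrt (fine (nsq f))); rewrite sqrtr_ge0; split=> //.
by apply: bnd_nsq; rewrite ?sqrtr_ge0// -E.
Qed.

Lemma l2P f : l2 f <-> isl2 f.
Proof.
split=> [/l2_bnd[c [_ fc _]]|[c fc]]; first by exists c.
split; first exact: bnd_onD fc.
by apply: le_lt_trans (nsq_bnd fc) _; rewrite ltry.
Qed.

Definition shifted V z f : pt -> R := fun x => Hop V f x - z * f x.

Lemma shiftedE V z f : onG f -> shifted V z f = fun x => negLap f x + (V x - z) * f x.
Proof. by move=> f0; apply/funext => x; rewrite /shifted HopE//; ring. Qed.

Lemma shiftedB V z f g : onG f -> onG g ->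
  shifted V z (f - g) = shifted V z f - shifted V z g.
Proof.
move=> f0 g0; rewrite !shiftedE//; last by move=> x Gx; rewrite !fctE f0// g0// subr0.
rewrite (goodB _ _ (good_negLap R)).
by apply/funext => x; rewrite !fctE; ring.
Qed.

Lemma isl2_Hop V z f : isl2 f -> isl2 (Hop V f) <-> isl2 (shifted V z f).
Proof.
move=> lf; have zf : isl2 (z *: f) by apply: isl2Z.
have E : Hop V f - z *: f = shifted V z f by [].
split=> H; first by rewrite -E; apply: isl2B.
have -> : Hop V f = shifted V z f + z *: f by rewrite -E subrK.
exact: isl2D.
Qed.

(** The inverse is a choice of solutions, with an arbitrary value outside l^2; uniqueness makes it a
    left inverse on the maximal domain. The constant becomes [C ^+ 2] because [nsq] is a squared
    norm. *)
Lemma resolventI V z C : 0 <= C ->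
  (forall g a, bnd g a -> exists2 u, bnd u (C * a) & shifted V z u = g) ->
  (forall u, isl2 u -> shifted V z u = 0 -> u = 0) ->
  resolvent V z.
Proof.
move=> C0 ex uni.
have /choice[Rs RsP] : forall g, exists u, l2 g ->
    [/\ isl2 u, shifted V z u = g & (nsq u <= (C ^+ 2)%:E * nsq g)%E].
  move=> g; have [lg|?] := pselect (l2 g); last by exists 0.
  have [c [c0 gc gE]] := l2_bnd lg; have [u uc uE] := ex _ _ gc.
  exists u => _; split=> //; first by exists (C * c).
  by rewrite gE -EFinM -exprMn; apply: nsq_bnd.
exists Rs, (C ^+ 2); split.
  move=> f lf; have [lu uE un] := RsP _ lf; split=> //; first exact/l2P.
    by apply/l2P/(isl2_Hop V z lu); rewrite uE; apply/l2P.
  by move=> x; rewrite -[in RHS]uE.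
move=> f /l2P lf /l2P lHf; have ls : isl2 (shifted V z f) by apply/isl2_Hop.
rewrite -/(shifted V z f).
have [lu uE _] := RsP _ ((l2P _).2 ls).
apply/eqP; rewrite -subr_eq0; apply/eqP/uni; first exact: isl2B.
by rewrite shiftedB ?uE ?subrr//; [case: lu => ? []|case: lf => ? []].
Qed.

Lemma resolvent_bnd V z : resolvent V z -> exists2 C, 0 <= C &
  forall f a, isl2 f -> bnd (shifted V z f) a -> bnd f (C * a).
Proof.
(* The constant in [resolvent] bounds squared norms and carries no sign, hence the absolute value
   under the root. *)
move=> [Rs [C [H1 H2]]]; exists (Num.sqrt `|C|); first exact: sqrtr_ge0.
move=> f a lf sa; have a0 := bnd_ge0 sa.
have ls : isl2 (shifted V z f) by exists a.
have RE : Rs (shifted V z f) = f by apply: H2; apply/l2P => //; apply/isl2_Hop; eauto.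
have [_ _ _] := H1 _ ((l2P _).2 ls); rewrite RE => nf.
have [c fc] := lf; apply: bnd_nsq; rewrite ?mulr_ge0 ?sqrtr_ge0//.
  exact: bnd_onD fc.
apply: le_trans nf _; rewrite exprMn sqr_sqrtr// EFinM.
have n0 : (0 <= nsq (shifted V z f))%E by apply: esum_ge0 => x _; rewrite lee_fin sqr_ge0.
apply: (@le_trans _ _ (`|C|%:E * nsq (shifted V z f))%E).
  by rewrite lee_wpmul2r// lee_fin ler_norm.
by rewrite lee_wpmul2l// ?lee_fin//; exact: nsq_bnd.
Qed.

Lemma shifted0 z f : onG f -> shifted (fun=> 0) z f = sub_scalar (@negLap R) z f.
Proof.
by move=> f0; rewrite shiftedE//; apply/funext => x; rewrite /sub_scalar !fctE /GRing.scale/=; ring.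
Qed.

Lemma negLap_form_bound c k : 0 < k ->
  (forall f, fs f -> (c - k) * dot f f <= dot (negLap f) f <= (c + k) * dot f f) ->
  forall f, fs f -> dot (sub_scalar (@negLap R) c f) (sub_scalar (@negLap R) c f)
    <= k ^+ 2 * dot f f.
Proof.
move=> k0 H; have gT := good_negLap R.
apply: numerical_range_bound => //; first exact: good_sub_scalar.
move=> f ff; rewrite (@dotBl _ _ G) ?(@dotZl _ _ G)//; [|exact: (good_fs gT)|exact: fsZ].
have /andP[h1 h2] := H _ ff.
by rewrite ler_norml; apply/andP; split; lra.
Qed.

Lemma negLap_bound c k : 0 < k -> c <= k -> 6 - c <= k ->
  forall f, fs f -> dot (sub_scalar (@negLap R) c f) (sub_scalar (@negLap R) c f)
    <= k ^+ 2 * dot f f.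
Proof.
move=> k0 ck c6; apply: negLap_form_bound => // f ff.
have /andP[h1 h2] := negLap_form ff; have := dot_ge0 f.
by move=> ?; apply/andP; split; nra.
Qed.

(** Without approximate eigenvectors the shifted operator is bounded below on finitely supported
    functions, and symmetry lets [bounded_below_solve] invert it. Conversely, approximate
    eigenvectors violate the resolvent bound. *)
Lemma spectrum0P z : spectrum (fun=> 0) z <-> apxev (@negLap R) z.
Proof.
have gT := good_negLap R; have gS := good_sub_scalar z gT.
split.
  apply: contra_notP => /existsNP[c /not_implyP[c0 nf]].
  have kb : 0 <= 6 + `|z| + 1 by rewrite !addr_ge0.
  have [||C [C0 ex uni]] := bounded_below_solve gS kb c0.
  - apply: negLap_bound; first by rewrite ltr_wpDl// addr_ge0.
      by have := ler_norm z; have := normr_ge0 z; lra.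
    by have := ler_norm (- z); rewrite normrN; lra.
  - move=> f ff; rewrite leNgt; apply/negP => h; apply: nf; by exists f.
  apply: (resolventI C0).
    move=> g a /ex[v vb vE]; exists v => //; rewrite shifted0//; exact: bnd_onD vb.
  move=> u lu; rewrite shifted0; first exact: uni.
  by case: lu => ? [].
move=> ap /resolvent_bnd[C C0 H].
(* The [+ 1] makes the product with [C ^+ 2] less than 1 and covers [C = 0]. *)
have c0 : 0 < (C ^+ 2 + 1)^-1 by rewrite invr_gt0 ltr_wpDl ?sqr_ge0.
have [f ff] := ap _ c0; have f0 := ff.1; have fS := good_fs gS ff.
have := H f (Num.sqrt (dot (sub_scalar (@negLap R) z f) (sub_scalar (@negLap R) z f)))
  (fs_isl2 ff).
rewrite shifted0// => /(_ _)/wrap[|fb].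
  by apply: dot_bnd; rewrite ?sqrtr_ge0// sqr_sqrtr ?dot_ge0.
have := bnd_dot fb ff; rewrite exprMn sqr_sqrtr ?dot_ge0//.
set N := dot f f; set M := dot _ _ => h1.
rewrite mulrC ltr_pdivlMr ?ltr_wpDl ?sqr_ge0//.
have : 0 <= M by exact: dot_ge0.
nra.
Qed.

(** Only the inverse of [V + c - z] enters the fixed-point equation, and it is bounded by [q^-1]
    even where [V] is unbounded. The contraction factor is [k / q]. *)
Lemma diagonal_dominant V z c k q : 0 < k -> k < q ->
  (forall f, fs f -> (c - k) * dot f f <= dot (negLap f) f <= (c + k) * dot f f) ->
  (forall x, G x -> q <= `|V x + c - z|) -> resolvent V z.
Proof.
move=> k0 kq ck H; have gT := good_negLap R; have gS := good_sub_scalar c gT.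
have q0 : 0 < q by apply: lt_trans kq.
have Sk : forall f a, bnd f a -> bnd (sub_scalar (@negLap R) c f) (k * a).
  by apply: (fs_bnd_extend gS (ltW k0)); apply: negLap_form_bound.
pose W x := (V x + c - z)^-1.
have Wq x : G x -> `|W x| <= q^-1.
  move=> /H Hx; rewrite normfV lef_pV2 ?posrE//.
  by apply: lt_le_trans Hx.
pose Phi f := (fun x => - W x * sub_scalar (@negLap R) c f x).
have Phib f a : bnd f a -> bnd (Phi f) (k / q * a).
  move=> /Sk fa; rewrite [k / q]mulrC -mulrA; apply: bndM => //.
    by rewrite invr_ge0 ltW.
  by move=> x /Wq; rewrite normrN.
have kq1 : 0 <= k / q < 1.
  by rewrite divr_ge0 ?(ltW k0) ?(ltW q0)//= ltr_pdivrMr ?mul1r.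
have PhiB f g : isl2 f -> isl2 g -> Phi (f - g) = Phi f - Phi g.
  move=> _ _; rewrite /Phi (goodB _ _ gS).
  by apply/funext => x; rewrite !fctE; ring.
have shE u : onG u -> shifted V z u =
    (fun x => sub_scalar (@negLap R) c u x + (V x + c - z) * u x).
  move=> u0; rewrite shiftedE//; apply/funext => x.
  by rewrite /sub_scalar !fctE /GRing.scale/=; ring.
have Dn0 x : G x -> V x + c - z != 0.
  by move=> /H Hx; rewrite -normr_gt0; apply: lt_le_trans Hx.
have S0 u x : onG u -> ~ G x -> sub_scalar (@negLap R) c u x = 0.
  by move=> u0 Gx; rewrite (good_onD gS u0 Gx).
apply: (@resolventI V z (q^-1 / (1 - k / q))).
- by rewrite divr_ge0 ?invr_ge0 ?subr_ge0 ?(ltW q0)//; case/andP: kq1 => _ /ltW.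
- move=> g a ga.
  have : bnd (fun x => W x * g x) (q^-1 * a).
    by apply: bndM ga => //; rewrite invr_ge0 ltW.
  case/(contraction_solve kq1 PhiB Phib) => u ub uE; exists u.
    by move: ub; congr bnd; rewrite mulrAC.
  have u0 := bnd_onD ub.
  rewrite shE//; apply/funext => x; have [Gx|Gx] := pselect (G x); last first.
    by rewrite S0// u0// (bnd_onD ga Gx) mulr0 addr0.
  rewrite [in X in _ + _ * X]uE !fctE /Phi /W.
  by field; exact: Dn0.
- move=> u lu; have u0 : onG u by case: lu => ? [].
  rewrite shE// => E; apply: (contraction_fix0 kq1 Phib) => //.
  apply/funext => x; rewrite /Phi; have [Gx|Gx] := pselect (G x); last first.
    by rewrite S0// u0// mulr0.
  have /eqP : sub_scalar (@negLap R) c u x + (V x + c - z) * u x = 0.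
    exact: (congr1 (fun h => h x) E).
  rewrite addrC addr_eq0 => /eqP Ex; rewrite mulNr -mulrN -Ex /W mulrA mulVf ?mul1r//.
  exact: Dn0.
Qed.

(* If [(A - mu)^2 >= m] is sharp, then factoring [(A - mu)^2 - m] shows that
   one of [mu - sqrt m], [mu + sqrt m] is an approximate eigenvalue. *)
Lemma spectral_gap mu r : 0 <= r ->
  (forall lam, mu - r <= lam <= mu + r -> ~ apxev (@negLap R) lam) ->
  exists2 k, r < k & forall f, fs f -> k ^+ 2 * dot f f <=
    dot (sub_scalar (@negLap R) mu f) (sub_scalar (@negLap R) mu f).
Proof.
move=> r0 H; have gT := good_negLap R; have gS := good_sub_scalar mu gT.
set B := sub_scalar _ mu in gS *.
have gB := good_sqr gS; pose K := 6 + `|mu| + 1.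
have K0 : 0 < K by rewrite ltr_wpDl// addr_ge0.
have BB f : fs f -> dot (B (B f)) f = dot (B f) (B f).
  by move=> ff; rewrite (good_sym gS)//; apply: good_fs.
have [||m [m0 mB ap]] := @lower_edge _ _ _ _ (K ^+ 2) gB (fs_nonzero R).
- exact: sqr_ge0.
- move=> f ff; rewrite BB// dot_ge0/=; apply: negLap_bound => //.
    by rewrite /K; have := ler_norm mu; have := normr_ge0 mu; lra.
  by rewrite /K; have := ler_norm (- mu); rewrite normrN; lra.
exists (Num.sqrt m); last by move=> f ff; rewrite sqr_sqrtr// -BB// mB.
rewrite ltNge; apply/negP => sr; set s := Num.sqrt m in sr.
have s0 : 0 <= s by exact: sqrtr_ge0.
have mE : m = s * s by rewrite -expr2 sqr_sqrtr.
have napx lam : mu - r <= lam <= mu + r -> exists2 c, 0 < c & forall f, fs f ->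
    c * dot f f <= dot (sub_scalar (@negLap R) lam f) (sub_scalar (@negLap R) lam f).
  move=> /H /existsNP[c /not_implyP[c0 nf]]; exists c => // f ff.
  by rewrite leNgt; apply/negP => h; apply: nf; exists f.
have [|c1 c10 H1] := napx (mu - s); first by apply/andP; split; lra.
have [|c2 c20 H2] := napx (mu + s); first by apply/andP; split; lra.
have [f ff] := ap _ (mulr_gt0 c10 c20).
have -> : sub_scalar (fun f => B (B f)) m f =
    sub_scalar (@negLap R) (mu - s) (sub_scalar (@negLap R) (mu + s) f).
  rewrite /B /sub_scalar !(goodB _ _ gT) !(goodZ _ _ gT) mE.
  by apply/funext => x; rewrite !fctE /GRing.scale/=; ring.
apply/negP; rewrite -leNgt; apply: le_trans (H1 _ _); last first.
  exact: (good_fs (good_sub_scalar _ gT)).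
by rewrite -mulrA ler_pM2l// H2.
Qed.

(* [H - z = B + (V - c)] with [B = A - (z - c)], where the inverse of [B] has norm
   at most [1 / k] by [spectral_gap] and [V - c] has norm at most [r < k]. *)
Lemma bounded_perturbation V z a b : (forall x, G x -> a <= V x <= b) ->
  (forall lam, z - b <= lam <= z - a -> ~ apxev (@negLap R) lam) -> resolvent V z.
Proof.
move=> Vab H; have gT := good_negLap R.
have ab : a <= b by have /andP[h1 h2] := Vab _ G0; apply: le_trans h2.
pose c := (a + b) / 2; pose r := (b - a) / 2.
have r0 : 0 <= r by rewrite /r; lra.
have [k rk Hk] : exists2 k, r < k & forall f, fs f -> k ^+ 2 * dot f f <=
    dot (sub_scalar (@negLap R) (z - c) f) (sub_scalar (@negLap R) (z - c) f).
  apply: spectral_gap => // lam /andP[h1 h2]; apply: H.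
  by rewrite /c /r in h1 h2; apply/andP; split; lra.
have k0 : 0 < k by apply: le_lt_trans rk.
have gS := good_sub_scalar (z - c) gT; set B := sub_scalar _ (z - c) in gS Hk.
pose K := 6 + `|z - c| + 1; have K0 : 0 < K by rewrite ltr_wpDl// addr_ge0.
have BK f : fs f -> dot (B f) (B f) <= K ^+ 2 * dot f f.
  apply: negLap_bound => //.
    by rewrite /K; have := ler_norm (z - c); have := normr_ge0 (z - c); lra.
  by rewrite /K; have := ler_norm (- (z - c)); rewrite normrN; lra.
have [C [C0 ex uni]] := bounded_below_solve gS (ltW K0) (exprn_gt0 2 k0) BK Hk.
(* The constant [C] of the Neumann series is too crude here; a contraction factor [r / k] requires
   the bound [1 / k] on the inverse. *)
have low := fs_lower_extend gS k0 (ltW K0) (fs_bnd_extend gS (ltW K0) BK) Hk.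
have /choice[Rs RsP] : forall g, exists v, isl2 g -> isl2 v /\ B v = g.
  move=> g; have [[e ge]|?] := pselect (isl2 g); last by exists 0.
  by have [v vb vE] := ex _ _ ge; exists v => _; split=> //; exists (C * e).
have Rsb g e : bnd g e -> bnd (Rs g) (e / k).
  by move=> ge; have [|lv vE] := RsP g; [exists e|apply: low; rewrite ?vE].
have RsB g h : isl2 g -> isl2 h -> Rs (g - h) = Rs g - Rs h.
  move=> lg lh; have [l1 E1] := RsP _ lg; have [l2 E2] := RsP _ lh.
  have [l3 E3] := RsP _ (isl2B lg lh).
  apply/eqP; rewrite -subr_eq0; apply/eqP/uni; first by apply: isl2B => //; apply: isl2B.
  by rewrite !(goodB _ _ gS) E1 E2 E3 subrr.
pose W f x := - (V x - c) * f x.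
have Wb f e : bnd f e -> bnd (W f) (r * e).
  apply: bndM => // x /Vab /andP[h1 h2]; rewrite normrN ler_norml /c /r.
  by apply/andP; split; lra.
have Wl f : isl2 f -> isl2 (W f) by move=> [e fe]; exists (r * e); apply: Wb.
pose Phi f := Rs (W f).
have rk1 : 0 <= r / k < 1.
  by rewrite divr_ge0 ?(ltW k0)//= ltr_pdivrMr ?mul1r.
have Phib f e : bnd f e -> bnd (Phi f) (r / k * e).
  by move=> /Wb /Rsb; congr bnd; rewrite mulrAC.
have PhiB f g : isl2 f -> isl2 g -> Phi (f - g) = Phi f - Phi g.
  move=> lf lg; rewrite /Phi -RsB//; try exact: Wl.
  by congr Rs; apply/funext => x; rewrite /W !fctE; ring.
have shE u : onG u -> shifted V z u = B u - W u.
  move=> u0; rewrite shiftedE//; apply/funext => x.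
  by rewrite /B /W /sub_scalar !fctE /GRing.scale/=; ring.
apply: (@resolventI V z (k^-1 / (1 - r / k))).
- by rewrite divr_ge0 ?invr_ge0 ?subr_ge0 ?(ltW k0)//; case/andP: rk1 => _ /ltW.
- move=> g e ge; have [u ub uE] := contraction_solve rk1 PhiB Phib (Rsb _ _ ge).
  exists u; first by move: ub; congr bnd; rewrite [RHS]mulrC mulrA.
  have lu : isl2 u by eexists; exact: ub.
  rewrite shE; last exact: bnd_onD ub.
  have [_ E1] := RsP g (ex_intro _ e ge); have [_ E2] := RsP _ (Wl _ lu).
  by rewrite {1}uE (goodD _ _ gS) E1 E2 addrK.
- move=> u lu; rewrite shE; last by case: lu => ? [].
  move=> /eqP; rewrite subr_eq0 => /eqP BW.
  apply: (contraction_fix0 rk1 Phib) => //.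
  have [l1 E1] := RsP _ (Wl _ lu).
  apply/eqP; rewrite -subr_eq0; apply/eqP/uni; first exact: isl2B.
  by rewrite (goodB _ _ gS) E1 BW subrr.
Qed.

(** * Spectral edges and potentials bounded on one side *)

Lemma bottom_of_spectrum : exists m,
  [/\ 0 <= m, forall f, fs f -> m * dot f f <= dot (negLap f) f & apxev (@negLap R) m].
Proof.
apply: (lower_edge (good_negLap R) (fs_nonzero R) (ler0n R 6)).
exact: negLap_form.
Qed.

(** This is [lower_edge] for 6 + Delta, whose form obeys the same bounds 0 and 6. *)
Lemma top_of_spectrum : exists m,
  [/\ m <= 6, forall f, fs f -> dot (negLap f) f <= m * dot f f & apxev (@negLap R) m].
Proof.
have gS := good_sub_scalar 6 (good_negLap R); set S0 := sub_scalar _ 6 in gS.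
have gT : good G (fun f => - S0 f).
  have := good_lincomb (- 2) gS gS; congr good; apply/funext => f; apply/funext => x.
  by rewrite !fctE /GRing.scale/=; ring.
have TE f : fs f -> dot (- S0 f) f = 6 * dot f f - dot (negLap f) f.
  move=> ff; rewrite -scaleN1r (@dotZl _ _ G); last exact: (good_fs gS).
  rewrite (@dotBl _ _ G) ?(@dotZl _ _ G)//; [|exact: (good_fs (good_negLap R))|exact: fsZ].
  by rewrite mulN1r opprB.
have [|m [m0 mT ap]] := lower_edge gT (fs_nonzero R) (ler0n R 6).
  move=> f ff; rewrite TE//; have /andP[h1 h2] := negLap_form ff.
  by apply/andP; split; lra.
exists (6 - m); split; first by lra.
  by move=> f ff; have := mT _ ff; rewrite TE//; lra.
move=> c c0; have [f ff fc] := ap c c0; exists f => //; move: fc.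
have -> : sub_scalar (fun f => - S0 f) m f = (-1) *: sub_scalar (@negLap R) (6 - m) f.
  by apply/funext => x; rewrite /S0 /sub_scalar !fctE /GRing.scale/=; ring.
have fS := good_fs (good_sub_scalar (6 - m) (good_negLap R)) ff.
rewrite (@dotZl _ _ G)// dotC (@dotZl _ _ G)//; lra.
Qed.

Lemma half_bounded_below V z a : (forall x, G x -> a <= V x) ->
  (forall lam, lam <= z - a -> ~ apxev (@negLap R) lam) -> resolvent V z.
Proof.
move=> Va H; have [m [m0 mA ap]] := bottom_of_spectrum.
have zm : z - a < m by rewrite ltNge; apply/negP => /H.
have m6 : m <= 6.
  have [f ff f0] := fs_nonzero R; rewrite -(ler_pM2r f0).
  by apply: le_trans (mA _ ff) _; case/andP: (negLap_form ff).
(* Centre and radius of [m, 7], which contains the free spectrum; 7 instead of 6 keeps the radius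
   positive even for [m = 6]. The condition [k < q] amounts to [z - a < m]. *)
apply: (@diagonal_dominant _ _ ((m + 7) / 2) ((7 - m) / 2)
  (a + (m + 7) / 2 - z)); try lra.
  move=> f ff; have := mA _ ff; have /andP[_ h2] := negLap_form ff.
  by have := dot_ge0 f; move=> ? ?; apply/andP; split; nra.
move=> x /Va Vx; rewrite ler_normr; apply/orP; left; lra.
Qed.

Lemma half_bounded_above V z b : (forall x, G x -> V x <= b) ->
  (forall lam, z - b <= lam -> ~ apxev (@negLap R) lam) -> resolvent V z.
Proof.
move=> Vb H; have [m [m6 mA ap]] := top_of_spectrum.
have zm : m < z - b by rewrite ltNge; apply/negP => /H.
have m0 : 0 <= m.
  have [f ff f0] := fs_nonzero R; rewrite -(ler_pM2r f0) mul0r.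
  by apply: le_trans (mA _ ff); case/andP: (negLap_form ff).
(* Centre and radius of [-1, m]; the end -1 keeps the radius positive for [m = 0]. *)
apply: (@diagonal_dominant _ _ ((m - 1) / 2) ((m + 1) / 2)
  (z - b - (m - 1) / 2)); try lra.
  move=> f ff; have := mA _ ff; have /andP[h1 _] := negLap_form ff.
  by have := dot_ge0 f; move=> ? ?; apply/andP; split; nra.
move=> x /Vb Vx; rewrite ler_normr; apply/orP; right; lra.
Qed.

Lemma spectrum_range V (a b : \bar R) :
  (forall x, G x -> (a <= (V x)%:E <= b)%E) ->
  spectrum V `<=` minksum (spectrum (fun=> 0)) (eitv a b).
Proof.
move=> Vab z; apply: contra_notP => nz.
have H lam : (a <= (z - lam)%:E <= b)%E -> ~ apxev (@negLap R) lam.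
  move=> h /spectrum0P ap; apply: nz; exists lam => //; exists (z - lam) => //.
  by rewrite addrC subrK.
case: a b Vab H {nz} => [a| |] [b| |] Vab H; try by have := Vab _ G0; rewrite ?leye_eq ?leeNy_eq ?andbF.
- apply: (@bounded_perturbation _ _ a b) => [x /Vab|lam ?]; first by rewrite !lee_fin.
  by apply: H; rewrite !lee_fin; apply/andP; split; lra.
- apply: (@half_bounded_below _ _ a) => [x /Vab|lam ?]; first by rewrite lee_fin leey andbT.
  by apply: H; rewrite lee_fin leey andbT; lra.
- apply: (@half_bounded_above _ _ b) => [x /Vab|lam ?]; first by rewrite lee_fin leNye.
  by apply: H; rewrite lee_fin leNye/=; lra.
(* Both ends infinite: the sum set is the whole line as soon as the free spectrum is nonempty. *)
- have [m [_ _ ap]] := bottom_of_spectrum.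
  by case: (H m _ ap); rewrite leNye leey.
Qed.

(** The interval [0, 6] has centre 3 and radius 3, and the hypothesis says that [V + 3 - z] has
    absolute value at least [3 + d]. *)
Lemma spectrum_diag V z d : 0 < d ->
  (forall x, G x -> V x <= z - 6 - d \/ z + d <= V x) -> resolvent V z.
Proof.
move=> d0 H; apply: (@diagonal_dominant _ _ 3 3 (3 + d)); try lra.
  move=> f ff; rewrite subrr mul0r; have := negLap_form ff; lra.
by move=> x /H [h|h]; rewrite ler_normr; apply/orP; [right|left]; lra.
Qed.

End Spectrum.

(** * Translated copies and Weyl sequences *)

Definition copy_shift (n k : nat) : pt :=
  ((2 ^ n)%N%:Z + (2 ^ (n.+1 + k))%N%:Z, 0).

(** The summand 1 leaves room for the base points of the triangles that contain [x]. *)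
Lemma copy_bound (s : seq pt) : exists n : nat,
  {in s, forall x : pt, `|x.1| + `|x.2| + 1 < (2 ^ n)%N%:Z}.
Proof.
have [m H] : exists m : nat, {in s, forall x : pt, `|x.1| + `|x.2| + 1 <= m%:Z}.
  elim: s => [|y s [m IH]]; first by exists 0%N.
  exists (m + `|y.1|%N + `|y.2|%N + 1)%N => x; rewrite inE => /orP[/eqP ->|/IH ?].
- lia.
- lia.
exists m => x /H; have := ltn_expl m (isT : 1 < 2)%N; lia.
Qed.

Lemma copy_base n k (x t : pt) : `|x.1| + `|x.2| + 1 < (2 ^ n)%N%:Z -> tri t x ->
  base (padd t (copy_shift n k)) <-> base t.
Proof.
move=> xn /triE tx; have tn : `|t.1| + `|t.2| < (2 ^ n)%N%:Z.
  by case: tx => ->; rewrite /=; lia.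
case: t tn {tx} => i j tn; rewrite /padd /copy_shift /= addr0.
exact: base_shift.
Qed.

Lemma copy_G n k (x : pt) : `|x.1| + `|x.2| + 1 < (2 ^ n)%N%:Z ->
  G x -> G (padd x (copy_shift n k)).
Proof.
move=> xn /GE[t [bt tx]]; apply/GE; exists (padd t (copy_shift n k)).
split; first exact/(copy_base k xn tx).
move/triE: tx; case: t x {xn bt} => [a b] [i j] tx; apply/triE; rewrite /padd /=.
by case: tx => -[-> ->]; [apply: Or31|apply: Or32|apply: Or33]; congr pair => /=; lia.
Qed.

(** Different shifts are at least [2 ^ n.+1] apart, while two points of the original piece differ by
    less than that. *)
Lemma copy_disjoint n k l (x y : pt) :
  `|x.1| + `|x.2| + 1 < (2 ^ n)%N%:Z -> `|y.1| + `|y.2| + 1 < (2 ^ n)%N%:Z ->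
  padd x (copy_shift n k) = padd y (copy_shift n l) -> k = l.
Proof.
wlog kl : k l x y / (k <= l)%N => [H xn yn E|xn yn].
  have [kl|/ltnW lk] := leqP k l; first exact: H kl xn yn E.
  exact/esym/(H _ _ _ _ lk yn xn (esym E)).
move: kl; rewrite leq_eqVlt => /orP[/eqP //|kl]; rewrite /padd /copy_shift => -[E _].
have h1 : (2 ^ n.+1 <= 2 ^ (n.+1 + k))%N by rewrite leq_exp2l// leq_addr.
have h2 : (2 ^ (n.+1 + k).+1 <= 2 ^ (n.+1 + l))%N by rewrite leq_exp2l// -addnS leq_add2l.
have := expnS 2 n; have := expnS 2 (n.+1 + k); lia.
Qed.

(** * Transplanted Weyl sequences *)

Section WeylSequence.
Variable R : realType.
Implicit Types (f g : pt -> R) (V : pt -> R) (v x : pt).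

Lemma bnd_translate f v a : onD G (translate f v) ->
  bnd G f a -> bnd G (translate f v) a.
Proof.
move=> t0 [_ a0 H]; split=> // s us.
have := H [seq (x.1 - v.1, x.2 - v.2) | x <- s]; rewrite /sumsq big_map; apply.
by rewrite map_inj_uniq// => -[i j] [k l] /= [/addIr -> /addIr ->].
Qed.

Lemma translateK f v : translate (translate f v) (- v.1, - v.2) = f.
Proof. by apply/funext => -[i j]; rewrite /translate /= !opprK !addrK. Qed.

Lemma bnd_untranslate f v a : onD G f -> bnd G (translate f v) a -> bnd G f a.
Proof.
move=> f0 H; rewrite -(translateK f v); apply: bnd_translate => //.
by rewrite translateK.
Qed.

Lemma apxev_spectrum V lam E : apxev G (@negLap R) lam ->
  (forall (s : seq pt) (e : R), 0 < e -> exists v,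
    {in s, forall x, (G x -> G (padd x v) /\ `|V (padd x v) - E| <= e) /\
      forall t, tri t x -> base (padd t v) <-> base t}) ->
  spectrum V (lam + E).
Proof.
move=> ap H /resolvent_bnd[C C0 Cb].
(* The Laplacian and the potential each contribute an error [e * nu]; then
   [C * (2 * e) = C / (C + 1) < 1] contradicts the resolvent bound. *)
pose e : R := (2 * (C + 1))^-1.
have C1 : 0 < 2 * (C + 1) by rewrite mulr_gt0// ltr_wpDl.
have e0 : 0 < e by rewrite invr_gt0.
have [f ff fe] := ap _ (exprn_gt0 2 e0).
have [f0 [s fs]] := ff; have [v Hv] := H s e e0.
set nu := Num.sqrt (dot f f); have nu0 : 0 <= nu by exact: sqrtr_ge0.
have nuE : nu ^+ 2 = dot f f by rewrite sqr_sqrtr ?dot_ge0.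
have nfx x : f x != 0 -> x \in s by apply: contraR => /fs ->.
pose h := translate f v.
have hG x : h x != 0 -> G x /\ `|V x - E| <= e.
  rewrite /h /translate; set y := (x.1 - v.1, x.2 - v.2) => fy.
  have -> : x = padd y v by case: (x) @y {fy} => a b; rewrite /padd /= !subrK.
  have Gy : G y by apply: contrapT => /f0 fy0; rewrite fy0 eqxx in fy.
  exact: (Hv _ (nfx _ fy)).1 Gy.
have h0 : onD G h.
  by move=> x Gx; apply/eqP; apply: contraT => /hG[].
have gS := good_sub_scalar lam (good_negLap R).
have AE : sub_scalar (@negLap R) lam h = translate (sub_scalar (@negLap R) lam f) v.
  apply/funext => x; rewrite /sub_scalar !fctE negLap_translate// => t y ty.
  by move=> /nfx /Hv[_]; apply.
have Sb : bnd G (sub_scalar (@negLap R) lam h) (e * nu).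
  rewrite AE; apply: bnd_translate; first by rewrite -AE; apply: (good_onD gS).
  apply: dot_bnd; [exact: good_fs|by rewrite mulr_ge0// ltW|].
  by rewrite exprMn nuE ltW.
have hb : bnd G h nu.
  by apply: bnd_translate => //; apply: dot_bnd => //; rewrite nuE.
(* Cut off where [h] vanishes, since [V] is controlled only on the copy. *)
pose W x := if h x != 0 then V x - E else 0.
have Wb : bnd G (fun x => W x * h x) (e * nu).
  apply: bndM hb; first exact: ltW.
  by move=> x _; rewrite /W; case: ifP => [/hG[]//|_]; rewrite normr0 ltW.
have shE : shifted V (lam + E) h = sub_scalar (@negLap R) lam h + (fun x => W x * h x).
  rewrite shiftedE//; apply/funext => x; rewrite /sub_scalar /W !fctE /GRing.scale/=.
  by case: (eqVneq (h x) 0) => [->|_] /=; ring.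
have := Cb h (e * nu + e * nu) (ex_intro _ _ hb).
rewrite shE => /(_ (bndD Sb Wb)) /(bnd_untranslate f0) /bnd_dot /(_ ff).
have fpos : 0 < dot f f.
  rewrite lt_neqAle dot_ge0 andbT eq_sym; apply/eqP => z.
  by move: fe; rewrite z mulr0 ltNge dot_ge0.
apply/negP; rewrite -ltNge -nuE.
have -> : (C * (e * nu + e * nu)) ^+ 2 = (C / (C + 1)) ^+ 2 * nu ^+ 2.
  by rewrite /e; field; rewrite gt_eqF// ltr_wpDl.
rewrite gtr_pMl ?nuE// expr_lt1// ?divr_ge0 ?addr_ge0//.
by rewrite ltr_pdivrMr ?mul1r ?ltrDl// ltr_wpDl.
Qed.

End WeylSequence.

(** * Almost sure events *)

Lemma ae_forall_countable {d : measure_display} {T : measurableType d} {R : realType}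
    (mu : {measure set T -> \bar R}) (I : countType) (Q : I -> T -> Prop) :
  (forall i, {ae mu, forall w, Q i w}) -> {ae mu, forall w, forall i, Q i w}.
Proof.
move=> H.
have : {ae mu, forall w, forall n, if unpickle n is Some i then Q i w else True}.
  by apply: ae_foralln => n; case: unpickle => // ; exact: aeW.
by apply: filterS => w Hw i; have := Hw (pickle i); rewrite pickleK.
Qed.

Section Anderson.
Context {R : realType} {d : measure_display} {Omega : measurableType d}.
Variables (P : probability Omega R) (V : pt -> Omega -> R) (P0 : probability R R).
Hypothesis VP : iid_family P V P0.
Implicit Types (s : seq pt) (x : pt) (w : Omega).

Lemma measurable_ball_itv (x e : R) : measurable (Defs.ball_itv x e).
Proof. exact: measurable_itv. Qed.

Lemma preimage_measurable x B : G x -> measurable B -> measurable (V x @^-1` B).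
Proof.
by move=> Gx mB; rewrite -[X in measurable X]setTI; apply: (VP.1 x Gx).
Qed.

(** Balls with rational centre and radius [n.+1%:R^-1] form a countable family, so one null set can
    serve all real centres and radii. *)
Lemma small_ratball (r e : R) : 0 < e -> exists (q : rat) (n : nat),
  [/\ n.+1%:R^-1 < e, `|ratr q - r| < n.+1%:R^-1 / 2 &
      Defs.ball_itv r (n.+1%:R^-1 / 2) `<=` Defs.ball_itv (ratr q) n.+1%:R^-1].
Proof.
move=> e0.
have [n ne] : exists n : nat, n.+1%:R^-1 < e.
  have := @near_infty_natSinv_lt R (PosNum e0).
  by case=> n _ /(_ n (leqnn n)) h; exists n.
set a : R := n.+1%:R^-1; have a0 : 0 < a by rewrite invr_gt0.
have [|q] := @rat_in_itvoo R (r - a / 2) (r + a / 2); first by lra.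
rewrite in_itv/= => /andP[h1 h2]; exists q, n; split=> //.
  by rewrite -/a ltr_norml; apply/andP; split; lra.
move=> y; rewrite /Defs.ball_itv /= !in_itv/= -/a => /andP[h3 h4].
by apply/andP; split; lra.
Qed.

(** The complement of the support is covered by countably many rational balls of measure zero. *)
Lemma ae_supp : {ae P0, forall r, supp P0 r}.
Proof.
have : {ae P0, forall r, forall qn : rat * nat,
    P0 (Defs.ball_itv (ratr qn.1) qn.2.+1%:R^-1) = 0%E ->
    ~ Defs.ball_itv (ratr qn.1) qn.2.+1%:R^-1 r}.
  apply: ae_forall_countable => -[q n] /=.
  set B := Defs.ball_itv _ _; have mB : measurable B by exact: measurable_ball_itv.
  have [B0|B0] := pselect (P0 B = 0%E); last by apply: aeW.
  exists B; split=> // r /=.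
  by move=> /not_implyP[_ /contrapT].
apply: filterS => r H e e0; rewrite lt_neqAle measure_ge0 andbT eq_sym.
apply/eqP => Pe; have e2 : 0 < e / 2 by rewrite divr_gt0.
have [q [n [ne qr sub]]] := small_ratball r e2.
have n0 : 0 < n.+1%:R^-1 :> R by rewrite invr_gt0.
have {}H := H (q, n); rewrite /= in H.
set a : R := n.+1%:R^-1 in H ne qr sub n0.
apply: H; last first.
  by apply: sub; rewrite /Defs.ball_itv /= in_itv/=; apply/andP; split; lra.
apply: (@subset_measure0 _ _ _ _ _ (Defs.ball_itv r e)) => //;
  try exact: measurable_ball_itv.
move: qr; rewrite ltr_norml => /andP[h1 h2] y.
by rewrite /Defs.ball_itv /= !in_itv/= => /andP[h3 h4]; apply/andP; split; lra.
Qed.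

Lemma ae_V_supp : {ae P, forall w x, G x -> supp P0 (V x w)}.
Proof.
apply: ae_forall_countable => x; have [Gx|Gx] := pselect (G x); last by apply: aeW.
have [N [mN N0 subN]] := ae_supp.
exists (V x @^-1` N); split; first exact: preimage_measurable.
  exact: etrans (VP.2.1 _ Gx _ mN) N0.
by move=> w /= /not_implyP[_ ns]; apply: subN.
Qed.

Definition cylinder B s : set Omega := \bigcap_(x in [set` s]) V x @^-1` B.

Lemma cylinder_measurable B s : measurable B -> {in s, forall x, G x} ->
  measurable (cylinder B s).
Proof.
move=> mB sG; apply: fin_bigcap_measurable; first exact: finite_seq.
by move=> x /sG Gx; exact: preimage_measurable.
Qed.

Lemma cylinder_cat B s t : cylinder B (s ++ t) = cylinder B s `&` cylinder B t.
Proof.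
apply/seteqP; split=> [w H|w [H1 H2] x /=].
  by split=> x /= xs; apply: H; rewrite /= mem_cat xs ?orbT.
by rewrite mem_cat => /orP[/H1|/H2].
Qed.

Lemma cylinder_prob B s : measurable B -> uniq s -> {in s, forall x, G x} ->
  P (cylinder B s) = (fine (P0 B) ^+ size s)%:E.
Proof.
move=> mB us sG; rewrite (VP.2.2 s (fun=> B))//.
have fB : P0 B = (fine (P0 B))%:E by rewrite fineK// fin_num_measure.
rewrite (@eq_big_seq _ _ _ _ _ _ (fun=> (fine (P0 B))%:E)); last first.
  by move=> x xs; exact: etrans (VP.2.1 _ (sG _ xs) _ mB) fB.
elim: {us sG} s => [|x s IH]; first by rewrite big_nil expr0.
by rewrite big_cons IH -EFinM -exprS.
Qed.

Variables (B : set R) (L : nat -> seq pt) (l : nat).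
Hypothesis mB : measurable B.
Hypothesis L_G : forall k, {in L k, forall x, G x}.
Hypothesis L_uniq : forall k, uniq (L k).
Hypothesis L_size : forall k, size (L k) = l.
Hypothesis L_disj : forall k m, k <> m -> ~~ has (mem (L k)) (L m).

Fixpoint avoid n : set Omega :=
  if n is m.+1 then avoid m `\` cylinder B (L m) else setT.

Lemma avoid_measurable n : measurable (avoid n).
Proof.
elim: n => [|n IH]; first exact: measurableT.
exact: (measurableD IH (cylinder_measurable mB (@L_G n))).
Qed.

(** Independence is given for cylinders only, not for their complements. Carrying an extra cylinder
    over [s] closes the induction: removing the copy [L n] subtracts the same quantity for
    [s ++ L n]. *)
Lemma avoid_prob n s : uniq s -> {in s, forall x, G x} ->
  (forall k, (k < n)%N -> ~~ has (mem (L k)) s) ->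
  P (cylinder B s `&` avoid n) =
    (fine (P0 B) ^+ size s * (1 - fine (P0 B) ^+ l) ^+ n)%:E.
Proof.
elim: n s => [|n IH] s us sG dis.
  by rewrite /= setIT mulr1 cylinder_prob.
have mC := cylinder_measurable mB sG; have mA := avoid_measurable n.
rewrite /= setIDA measureD; last first.
- by rewrite -ge0_fin_numE// fin_num_measure//; exact: measurableI.
- exact: cylinder_measurable.
- exact: measurableI.
rewrite setIAC -cylinder_cat.
have E1 := IH s us sG (fun k kn => dis k (ltnW kn)).
have E2 : P (cylinder B (s ++ L n) `&` avoid n) =
    (fine (P0 B) ^+ size (s ++ L n) * (1 - fine (P0 B) ^+ l) ^+ n)%:E.
  apply: IH.
  - by rewrite cat_uniq us L_uniq andbT/= has_sym dis.
  - by move=> x; rewrite mem_cat => /orP[/sG|/L_G].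
  - move=> k kn; rewrite has_cat negb_or dis ?ltnS 1?ltnW//=.
    by apply: L_disj => E; rewrite E ltnn in kn.
apply: etrans (congr2 (fun a b => (a - b)%E) E1 E2) _.
by rewrite size_cat L_size -EFinB; congr EFin; rewrite exprD exprSr; ring.
Qed.

(** The first [n] copies all fail with probability [(1 - p ^+ l) ^+ n], where [p] is the mass of
    [B], and this tends to 0. *)
Lemma ae_some_copy : (0 < P0 B)%E ->
  {ae P, forall w, exists k, {in L k, forall x, B (V x w)}}.
Proof.
move=> B0; exists (\bigcap_n avoid n); split.
- by apply: bigcapT_measurable; exact: avoid_measurable.
- have mI : measurable (\bigcap_n avoid n).
    by apply: bigcapT_measurable; exact: avoid_measurable.
  set p := fine (P0 B).
  have pE : P0 B = p%:E by rewrite fineK// fin_num_measure.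
  have p0 : 0 < p by rewrite -lte_fin -pE.
  have p1 : p <= 1 by rewrite -lee_fin -pE probability_le1.
  have q01 : 0 <= 1 - p ^+ l < 1.
    by rewrite subr_ge0 exprn_ile1 ?(ltW p0)//= ltrBlDr ltrDl exprn_gt0.
  apply/eqP; rewrite eq_le measure_ge0 andbT; apply/lee_addgt0Pr => e e0.
  have [n ne] := geometric_small 1 q01 e0; rewrite add0e.
  apply: (@le_trans _ _ (P (avoid n))).
    apply: le_measure; rewrite ?inE//; first exact: avoid_measurable.
    exact: bigcap_inf.
  have := @avoid_prob n [::] isT; rewrite /cylinder.
  rewrite set_nil bigcap_set0 setTI => -> //.
  by rewrite lee_fin -/p ltW.
move=> w /= nk n _; elim: n => [//|n IH]; split=> // cyl; apply: nk.
by exists n.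
Qed.

End Anderson.

(** * Copies for all parameters at once, and the distance to the support *)

Section AlmostSure.
Context {R : realType} {d : measure_display} {Omega : measurableType d}.
Variables (P : probability Omega R) (V : pt -> Omega -> R) (P0 : probability R R).
Hypothesis VP : iid_family P V P0.

(** The null set must be chosen before [E] and [e], which range over uncountable sets; it is taken
    for the countably many triples of a finite list, a rational centre and a radius. *)
Lemma ae_copies : {ae P, forall w, forall (s : seq pt) (e E : R), supp P0 E -> 0 < e ->
  exists v, {in s, forall x,
    (G x -> G (padd x v) /\ `|V (padd x v) w - E| <= e) /\
    forall t, tri t x -> base (padd t v) <-> base t}}.
Proof.
have : {ae P, forall w, forall p : seq pt * rat * nat,
    (0 < P0 (Defs.ball_itv (ratr p.1.2) p.2.+1%:R^-1))%E ->
    exists v, {in p.1.1, forall x,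
      (G x -> G (padd x v) /\
        Defs.ball_itv (ratr p.1.2) p.2.+1%:R^-1 (V (padd x v) w)) /\
      forall t, tri t x -> base (padd t v) <-> base t}}.
  apply: ae_forall_countable => -[[s q] m] /=; set B := Defs.ball_itv _ _.
  have mB : measurable B by exact: measurable_ball_itv.
  have [B0|nB] := pselect (0 < P0 B)%E; last by apply: aeW => ? /nB.
  have [n sn] := copy_bound s.
  pose s' := undup [seq x <- s | `[< G x >]].
  have s'P x : x \in s' -> x \in s /\ G x.
    by rewrite mem_undup mem_filter => /andP[/asboolP Gx ->].
  pose L k := [seq padd x (copy_shift n k) | x <- s'].
  have LG k : {in L k, forall x, G x}.
    by move=> _ /mapP[x /s'P[xs Gx] ->]; apply: copy_G => //; apply: sn.
  have Lu k : uniq (L k).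
    rewrite map_inj_uniq ?undup_uniq// => -[a b] [a' b'] [].
    by move=> /addIr -> /addIr ->.
  have Ls k : size (L k) = size s' by rewrite size_map.
  have Ld k m' : k <> m' -> ~~ has (mem (L k)) (L m').
    move=> km; apply/hasPn => _ /mapP[x /s'P[xs _] ->]; apply/negP => /mapP[y /s'P[ys _] E].
    by apply: km; apply/esym; apply: copy_disjoint (sn _ xs) (sn _ ys) E.
  have := ae_some_copy VP mB LG Lu Ls Ld B0.
  apply: filterS => w [k Hk] _; exists (copy_shift n k) => x xs; split.
    move=> Gx; split; first by apply: copy_G => //; apply: sn.
    by apply: Hk; apply: map_f; rewrite mem_undup mem_filter xs andbT; apply/asboolP.
  by move=> t; apply: copy_base; apply: sn.
apply: filterS => w H s e E sE e0; have e2 : 0 < e / 2 by rewrite divr_gt0.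
have [q [n [ne qE sub]]] := small_ratball E e2.
have {}H := H (s, q, n); rewrite /= in H.
have n0 : 0 < n.+1%:R^-1 :> R by rewrite invr_gt0.
set a : R := n.+1%:R^-1 in H ne qE sub n0.
have [|v Hv] := H.
  apply: lt_le_trans (sE (a / 2) _) _; first by rewrite divr_gt0.
  by apply: le_measure => //; rewrite inE; exact: measurable_ball_itv.
exists v => x /Hv[H1 H2]; split=> // /H1[Gv]; rewrite /Defs.ball_itv /= in_itv/=.
move=> /andP[h1 h2]; split=> //; move: qE; rewrite ltr_norml => /andP[h3 h4].
by rewrite ler_norml; apply/andP; split; lra.
Qed.

Lemma supp_far (z : R) : ~ supp P0 z ->
  exists2 e, 0 < e & forall v, supp P0 v -> e <= `|v - z|.
Proof.
move=> /existsNP[e /not_implyP[e0 Pe]]; exists e => // v sv.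
rewrite leNgt; apply/negP; rewrite ltr_norml => /andP[h1 h2]; apply: Pe.
(* The distance from [v] to the nearer end of the null interval around [z]. *)
pose r := Num.min (e - (v - z)) (e + (v - z)).
have r0 : 0 < r by rewrite lt_min; apply/andP; split; lra.
apply: lt_le_trans (sv r r0) _; apply: le_measure; rewrite ?inE;
  try exact: measurable_ball_itv.
have [r1 r2] : r <= e - (v - z) /\ r <= e + (v - z).
  by rewrite !ge_min !lexx orbT.
move=> y; rewrite /Defs.ball_itv /= !in_itv/= => /andP[h3 h4].
by apply/andP; split; lra.
Qed.

(** If z is not in the sum set, the support misses [z - 6, z]. As the support is closed, it stays a
    positive distance away from both ends, which is the gap that [spectrum_diag] needs. *)
Lemma spectrum_sub_supp (v : pt -> R) : (forall x, G x -> supp P0 (v x)) ->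
  spectrum v `<=` minksum `[0, 6]%classic (supp P0).
Proof.
move=> vs z; apply: contra_notP => nz.
have far (a : R) : 0 <= a <= 6 -> ~ supp P0 (z - a).
  move=> a06 sz; apply: nz; exists a; first by rewrite /= in_itv.
  by exists (z - a) => //; rewrite addrC subrK.
have [e1 e10 H1] : exists2 e, 0 < e & forall y, supp P0 y -> e <= `|y - (z - 0)|.
  by apply: supp_far; apply: far; apply/andP; split; lra.
have [e2 e20 H2] : exists2 e, 0 < e & forall y, supp P0 y -> e <= `|y - (z - 6)|.
  by apply: supp_far; apply: far; apply/andP; split; lra.
pose e := Num.min e1 e2; have e0 : 0 < e by rewrite lt_min e10.
have [ee1 ee2] : e <= e1 /\ e <= e2 by rewrite !ge_min !lexx orbT.
apply: (spectrum_diag e0) => x /vs sx.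
have [h|h] := leP (v x) (z - 6).
  left; have := H2 _ sx; rewrite ler0_norm; lra.
have [h'|h'] := leP z (v x).
  right; have := H1 _ sx; rewrite ger0_norm; lra.
have := far (z - v x); rewrite subKr => /(_ _ sx)[].
by apply/andP; split; lra.
Qed.

End AlmostSure.

Unset Implicit Arguments.

Theorem theorem1p1 (R : realType) (d : measure_display)
    (Omega : measurableType d) (P : probability Omega R)
    (P0 : probability R R) (V : pt -> Omega -> R) :
  iid_family P V P0 ->
  {ae P, forall w,
     minksum (spectrum (fun _ => 0)) (supp P0) `<=` spectrum (fun x => V x w) /\
     spectrum (fun x => V x w) `<=`
       minksum (spectrum (fun _ => 0))
            (eitv (ereal_inf [set (V x w)%:E | x in G])
                  (ereal_sup [set (V x w)%:E | x in G]))} /\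
  {ae P, forall w,
     spectrum (fun x => V x w) `<=` minksum `[0, 6]%classic (supp P0)} /\
  (forall a b : \bar R, (a < b)%E -> supp P0 = eitv a b ->
     {ae P, forall w,
        spectrum (fun x => V x w) = minksum (spectrum (fun _ => 0)) (supp P0)}).
Proof.
move=> VP; have copies := ae_copies VP; have supp_V := ae_V_supp VP.
have lower : {ae P, forall w,
    minksum (spectrum (fun _ => 0)) (supp P0) `<=` spectrum (fun x => V x w)}.
  apply: filterS copies => w H _ [lam /spectrum0P ap [E sE <-]].
  by apply: apxev_spectrum ap _ => s e e0; apply: H.
split; [|split].
- apply: filterS lower => w low; split=> //; apply: spectrum_range => x Gx.
  by rewrite ereal_inf_lbound ?ereal_sup_ubound//; exists x.
- by apply: filterS supp_V => w /spectrum_sub_supp.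
(* Since the potential takes values in the support, [spectrum_range] applies with [a] and [b]
   themselves, and the extrema of [V] need not be computed. *)
- move=> a b _ sE; apply: filterS2 lower supp_V => w low sV.
  apply/seteqP; split=> //; rewrite sE; apply: spectrum_range => x /sV.
  by rewrite sE.
Qed.
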